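(* Let $G=\sum_{m=0}^{\infty}\frac{(-1)^m}{(2m+1)^2}$ be Catalan's constant. With $\nu$, $\mathrm{MC}_4$ and $C_4$ as defined in the context, put, for positive integers $n$, $$E_4(n):=G-\frac{1}{4096}\sum_{m=0}^{n-1}\frac{\nu(m)}{4096^m}-\frac{1}{4096^{n+1}}\mathrm{MC}_4(n).$$ Then for all integers $n\ge 12$, $$\frac{C_4}{4095\cdot 4096^n\,n^{13}}<E_4(n)<\frac{C_4}{4095\cdot 4096^n(n+5)^{13}}.$$
   Context: $$\nu(m)=\tfrac{36864}{(24m+2)^2}-\tfrac{30720}{(24m+3)^2}-\tfrac{30720}{(24m+4)^2}-\tfrac{6144}{(24m+6)^2}-\tfrac{1536}{(24m+7)^2}+\tfrac{2304}{(24m+9)^2}+\tfrac{2304}{(24m+10)^2}+\tfrac{768}{(24m+14)^2}+\tfrac{480}{(24m+15)^2}+\tfrac{384}{(24m+11)^2}+\tfrac{1536}{(24m+12)^2}+\tfrac{24}{(24m+19)^2}-\tfrac{120}{(24m+20)^2}-\tfrac{36}{(24m+21)^2}+\tfrac{48}{(24m+22)^2}-\tfrac{6}{(24m+23)^2}.$$ The known BBP-type formula $G=\frac{1}{4096}\sum_{m\ge0}\nu(m)/4096^m$ holds. Finite continued fraction notation: $K_{j=1}^{k}\frac{a_j}{n+b_j}$ means $\cfrac{a_1}{n+b_1+\cfrac{a_2}{n+b_2+\cdots+\cfrac{a_k}{n+b_k}}}$. $$\mathrm{MC}_4(n)=\frac{-\frac{128}{3}}{(n+\frac{13}{72})^2+\frac{41}{432}+K_{j=1}^{4}\frac{a_j}{n+b_j}},$$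 where $a_1=-\frac{517}{23328}$, $b_1=\frac{156655}{148896}$; $a_2=\frac{366823315}{821111808}$, $b_2=-\frac{73939238279831}{163855572930720}$; $a_3=-\frac{975884794104398189}{98093762087712545025}$, $b_3=-\frac{1932406340618716298628867667}{299122227350085279497481360}$; $a_4=\frac{1518828040567790867982188908085299115}{24627466973909279332577879325543168}$, $b_4=\frac{10414320422851149518238529301402392329619615007}{1125439555781241535752796061860324225756510608}$. $C_4=-\frac{59816694319657990230589749754634406261775}{191377827680729835340592443669705291028496384}$ (a negative number). *)

(* Defs.v *)
(* Stdlib reals with Coquelicot. *)
From Stdlib Require Export Reals List.
From Coquelicot Require Export Coquelicot.
Export ListNotations.
Open Scope R_scope.

Definition Catalan : R :=
  Series (fun m : nat => (-1) ^ m / (2 * INR m + 1) ^ 2).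

Definition nu (m : nat) : R :=
    36864 / (24 * INR m + 2) ^ 2
  - 30720 / (24 * INR m + 3) ^ 2
  - 30720 / (24 * INR m + 4) ^ 2
  - 6144 / (24 * INR m + 6) ^ 2
  - 1536 / (24 * INR m + 7) ^ 2
  + 2304 / (24 * INR m + 9) ^ 2
  + 2304 / (24 * INR m + 10) ^ 2
  + 768 / (24 * INR m + 14) ^ 2
  + 480 / (24 * INR m + 15) ^ 2
  + 384 / (24 * INR m + 11) ^ 2
  + 1536 / (24 * INR m + 12) ^ 2
  + 24 / (24 * INR m + 19) ^ 2
  - 120 / (24 * INR m + 20) ^ 2
  - 36 / (24 * INR m + 21) ^ 2
  + 48 / (24 * INR m + 22) ^ 2
  - 6 / (24 * INR m + 23) ^ 2.

(* [contfrac [(a_1, b_1); ...; (a_k, b_k)] x] is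
   a_1 / (x + b_1 + a_2 / (x + b_2 + ... + a_k / (x + b_k))). *)
Fixpoint contfrac (ab : list (R * R)) (x : R) : R :=
  match ab with
  | [] => 0
  | (a, b) :: ab' => a / (x + b + contfrac ab' x)
  end.

Definition MC4_coeffs : list (R * R) :=
  [ (- (517 / 23328),
     156655 / 148896);
    (366823315 / 821111808,
     - (73939238279831 / 163855572930720));
    (- (975884794104398189 / 98093762087712545025),
     - (1932406340618716298628867667 / 299122227350085279497481360));
    (1518828040567790867982188908085299115
       / 24627466973909279332577879325543168,
     10414320422851149518238529301402392329619615007
       / 1125439555781241535752796061860324225756510608) ].

Definition MC4 (x : R) : R :=
  - (128 / 3) / ((x + 13 / 72) ^ 2 + 41 / 432 + contfrac MC4_coeffs x).

Definition C4 : R :=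
  - (59816694319657990230589749754634406261775
       / 191377827680729835340592443669705291028496384).

(* [sum_f_R0 f N] includes the term [f N]: for n >= 1 the sum below ranges
   over m = 0, ..., n - 1. The value at n = 0 is irrelevant. *)
Definition E4 (n : nat) : R :=
  Catalan
  - 1 / 4096 * sum_f_R0 (fun m : nat => nu m / 4096 ^ m) (n - 1)
  - 1 / 4096 ^ (n + 1) * MC4 (INR n).

(* Main.v *)
(* The series of the BBP-type formula is a combination of real and imaginary
   parts of [Li_2 z] at points [z] of modulus [1 / sqrt 2] and [1 / 2] whose
   arguments are multiples of [PI / 12]. On the circle [|z| = r] the involution
   [a |-> (r^2 - a) / (1 - a)] makes the sum of the real parts of [Li_2]
   at [a] and at its image equal to [arg (1 - a) ^ 2] plus a constant; three
   instances of this make all the real parts cancel. The imaginary parts reduce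
   to the inverse tangent integral at [tan (PI / 12)], hence to Catalan's
   constant by the triplication formula of the tangent.

   For the estimate, [4096 ^ (n + 1) * (E4 n - E4 (n + 1))] is a rational
   function of [n] lying between [C4 / n ^ 13] and [C4 / (n + 4) ^ 13]: in the
   variable [n - 12] all the numerators and denominators involved have
   coefficients of constant sign. Summing over [n] gives the theorem, as [E4]
   tends to [0]. *)

(* All dilogarithms are real series in polar coordinates. An identity between them is proved by
   letting radius or argument vary, checking that a combination has derivative 0, and comparing its
   values at the ends of an interval. Radius 1, where Catalan's constant appears, is reached by
   continuity only: termwise continuity is needed up to the unit circle, termwise differentiation
   only inside it. The base 4096 comes from [(/ sqrt 2) ^ 24] and [(1 / 2) ^ 12]: multiples of
   [PI / 12] have period 24, and the arguments used with modulus [1 / 2] have period 12, so one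
   block of each series makes up one [nu m]. The factor [1 / (4095 * 4096 ^ n)] is the sum of
   [1 / 4096 ^ (m + 1)] over [m >= n]. Freezing the 13th power at [m = n] therefore gives the lower
   bound directly, as [C4] is negative. For the upper bound, freezing at [n + 4] errs in the wrong
   direction; the shift 5 absorbs the decay of the later terms. *)
Require Import Defs.
From Stdlib Require Import Lra Lia ZArith Bool.

(** * Series of functions *)

(** Weierstrass M-test: near [x0] the tails are dominated by those of [M], and a partial sum is
    continuous, so three errors of [eps / 3] suffice. *)
Lemma continuous_Series (u : nat -> R -> R) (M : nat -> R) (x0 : R) :
  (forall k, continuous (u k) x0) ->
  locally x0 (fun x => forall k, Rabs (u k x) <= M k) ->
  ex_series M ->
  continuous (fun x => Series (fun k => u k x)) x0.
Proof.
intros Hu Hb HM.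
assert (Hex : forall x N, (forall k, Rabs (u k x) <= M k) ->
  ex_series (fun k => u k x) /\
  Rabs (Series (fun k => u k x) - sum_n (fun k => u k x) N)
    <= Series M - sum_n M N).
{ intros x N Hx.
  assert (Ha : ex_series (fun k => Rabs (u k x))).
  { apply (@ex_series_le R_AbsRing R_CompleteNormedModule _ M); [|exact HM].
    intros k; unfold norm; simpl; unfold abs; simpl.
    rewrite Rabs_Rabsolu; apply Hx. }
  pose proof (ex_series_Rabs _ Ha) as He; split; [exact He|].
  rewrite (Series_incr_n _ (S N)), (Series_incr_n M (S N)); try lia; trivial.
  simpl pred; rewrite <- !sum_n_Reals.
  replace (_ - _) with (Series (fun k => u (S N + k)%nat x)) by ring.
  replace (_ - _) with (Series (fun k => M (S N + k)%nat)) by ring.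
  eapply Rle_trans.
  - apply Series_Rabs, (ex_series_incr_n (fun k => Rabs (u k x)) (S N)), Ha.
  - apply Series_le.
    + intros k; split; [apply Rabs_pos|apply Hx].
    + apply (ex_series_incr_n M (S N)), HM. }
apply (filterlim_locally (F := locally x0)); intros eps.
assert (HS : is_lim_seq (sum_n M) (Series M)) by exact (Series_correct M HM).
apply is_lim_seq_spec in HS.
assert (He : 0 < eps / 3) by (destruct eps; simpl; lra).
destruct (HS (mkposreal _ He)) as [N HN].
specialize (HN N (Nat.le_refl N)); simpl in HN.
assert (HcN : continuous (fun x => sum_n (fun k => u k x) N) x0).
{ clear HN; induction N as [|N IH].
  - apply (continuous_ext (u 0%nat)); [|apply Hu].
    intros x; now rewrite sum_O.
  - apply (continuous_ext (fun x => plus (sum_n (fun k => u k x) N) (u (S N) x))).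
    + intros x; now rewrite sum_Sn.
    + apply (continuous_plus (V := R_NormedModule)); [exact IH|apply Hu]. }
pose proof (proj1 (filterlim_locally _ _) HcN (mkposreal _ He)) as Hc.
generalize (filter_and _ _ Hb Hc); apply filter_imp; intros x [Hx Hd].
destruct (Hex x N Hx) as [_ H1].
destruct (Hex x0 N (locally_singleton _ _ Hb)) as [_ H2].
unfold ball in *; simpl in *; unfold AbsRing_ball, abs, minus, plus, opp in *;
  simpl in *.
apply Rabs_def2 in HN; apply Rabs_def2 in Hd.
apply Rabs_le_between in H1; apply Rabs_le_between in H2.
apply Rabs_def1; lra.
Qed.

(** A Lipschitz bound relative to [x0] plays the part of uniform convergence of the derivatives: it
    lets the M-test apply to the series of difference quotients. *)
Lemma is_derive_Series (f : nat -> R -> R) (f' M : nat -> R) (x0 : R) :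
  (forall k, is_derive (f k) x0 (f' k)) ->
  (forall k, Rabs (f' k) <= M k) ->
  locally x0 (fun x : R => forall k,
    Rabs (f k x - f k x0) <= M k * Rabs (x - x0)) ->
  locally x0 (fun x => ex_series (fun k => f k x)) ->
  ex_series M ->
  is_derive (fun x => Series (fun k => f k x)) x0 (Series f').
Proof.
intros Hf Hf' Hb He HM.
(* The difference quotient, extended at [h = 0] by the derivative. Continuity at 0 of the sum of the
   [u k] is the claim. *)
set (u := fun k h =>
  if Req_EM_T h 0 then f' k else (f k (x0 + h) - f k x0) / h).
assert (Hshift : forall P : R -> Prop,
  locally x0 P -> locally 0 (fun h => P (x0 + h))).
{ intros P [d Hd]; exists d; intros h Hh; apply Hd.
  unfold ball in *; simpl in *.
  unfold AbsRing_ball, abs, minus, plus, opp in *; simpl in *.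
  now replace (x0 + h + - x0) with (h + - 0) by ring. }
assert (Hu : continuous (fun h => Series (fun k => u k h)) 0).
{ apply (continuous_Series u M).
  - intros k; apply (filterlim_locally (F := locally 0)); intros eps.
    destruct (proj1 (is_derive_Reals _ _ _) (Hf k) eps (cond_pos eps))
      as [d Hd].
    exists d; intros h Hh.
    unfold ball in *; simpl in *.
    unfold AbsRing_ball, abs, minus, plus, opp in *; simpl in *.
    rewrite Ropp_0, Rplus_0_r in Hh; unfold u.
    destruct (Req_EM_T 0 0) as [_|N]; [|now elim N].
    destruct (Req_EM_T h 0) as [_|N].
    + rewrite Rplus_opp_r, Rabs_R0; apply cond_pos.
    + exact (Hd h N Hh).
  - generalize (Hshift _ Hb); apply filter_imp; intros h Hh k; unfold u.
    specialize (Hh k); simpl in h; replace (x0 + h - x0) with h in Hh by ring.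
    destruct (Req_EM_T h 0) as [_|N]; [apply Hf'|].
    unfold Rdiv; rewrite Rabs_mult, Rabs_inv.
    apply (Rmult_le_reg_r (Rabs h)); [now apply Rabs_pos_lt|].
    rewrite Rmult_assoc, Rinv_l, Rmult_1_r; [exact Hh|now apply Rabs_no_R0].
  - exact HM. }
apply is_derive_Reals; intros eps Heps.
pose proof (proj1 (filterlim_locally _ _) Hu (mkposreal _ Heps)) as Hc.
generalize (filter_and _ _ Hc (Hshift _ He)); intros [d Hd].
exists d; intros h Hh Hhd.
destruct (Hd h) as [H1 H2].
{ unfold ball; simpl; unfold AbsRing_ball, abs, minus, plus, opp; simpl.
  now rewrite Ropp_0, Rplus_0_r. }
unfold ball in H1; simpl in H1.
unfold AbsRing_ball, abs, minus, plus, opp in H1; simpl in H1.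
rewrite (Series_ext (fun k => u k 0) f') in H1.
2:{ intros k; unfold u; destruct (Req_EM_T 0 0) as [_|N]; [easy|now elim N]. }
rewrite (Series_ext (fun k => u k h) (fun k => (f k (x0 + h) - f k x0) * / h))
  in H1.
2:{ intros k; unfold u; destruct (Req_EM_T h 0) as [N|_]; [now elim Hh|easy]. }
rewrite Series_scal_r, Series_minus in H1; try easy.
exact (locally_singleton _ _ He).
Qed.

(** * The dilogarithm in polar coordinates *)

(** Only continuity is asked at the ends, because some identities below are evaluated where the
    radius is 1. *)
Lemma constant_on_interval (f : R -> R) (a b : R) :
  a <= b ->
  (forall x, a <= x <= b -> continuous f x) ->
  (forall x, a < x < b -> is_derive f x 0) -> f a = f b.
Proof.
intros Hab Hc Hd.
destruct (MVT_gen f a b (fun _ => 0)) as [c [_ Hf]].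
- rewrite Rmin_left, Rmax_right by lra; exact Hd.
- rewrite Rmin_left, Rmax_right by lra; intros x Hx.
  now apply continuity_pt_filterlim, Hc.
- lra.
Qed.

Lemma Rabs_pow_sub_le (r s p : R) (k : nat) :
  Rabs r <= p -> Rabs s <= p ->
  Rabs (r ^ S k - s ^ S k) <= INR (S k) * p ^ k * Rabs (r - s).
Proof.
intros Hr Hs.
assert (Hp : 0 <= p) by (pose proof (Rabs_pos r); lra).
induction k as [|k IH]; [simpl; rewrite !Rmult_1_r, !Rmult_1_l; lra|].
replace (r ^ S (S k) - s ^ S (S k))
  with (r * (r ^ S k - s ^ S k) + (r - s) * s ^ S k) by (simpl; ring).
eapply Rle_trans; [apply Rabs_triang|]; rewrite !Rabs_mult.
assert (H1 : Rabs r * Rabs (r ^ S k - s ^ S k)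
  <= p * (INR (S k) * p ^ k * Rabs (r - s))).
{ apply Rmult_le_compat; auto using Rabs_pos. }
assert (H2 : Rabs (r - s) * Rabs (s ^ S k) <= Rabs (r - s) * p ^ S k).
{ apply Rmult_le_compat_l; [apply Rabs_pos|].
  rewrite <- RPow_abs; apply pow_incr; split; [apply Rabs_pos|exact Hs]. }
rewrite (S_INR (S k)); simpl pow in *; nra.
Qed.

Lemma Rabs_cos_sub_le (a b : R) : Rabs (cos a - cos b) <= Rabs (a - b).
Proof.
destruct (MVT_gen cos b a (fun x => - sin x)) as [c [_ H]].
- intros x _; auto_derive; [easy|ring].
- intros x _; apply continuity_pt_filterlim, continuous_cos.
- rewrite H, Rabs_mult, Rabs_Ropp.
  pose proof (Rabs_pos (a - b)).
  assert (Rabs (sin c) <= 1) by (apply Rabs_le, SIN_bound).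
  nra.
Qed.

(** Provides the Lipschitz hypothesis of [is_derive_Series] for terms in which radius and angle both
    vary. *)
Lemma is_derive_locally_lipschitz (f : R -> R) (x l : R) :
  is_derive f x l ->
  locally x (fun y : R => Rabs (f y - f x) <= (Rabs l + 1) * Rabs (y - x)).
Proof.
intros H; apply is_derive_Reals in H.
destruct (H 1 Rlt_0_1) as [d Hd]; exists d; intros y Hy.
unfold ball in Hy; simpl in Hy; unfold AbsRing_ball, abs, minus, plus, opp in Hy;
  simpl in Hy, y.
destruct (Req_EM_T y x) as [->|N]; [rewrite !Rminus_diag, Rabs_R0; lra|].
specialize (Hd (y - x) ltac:(lra) Hy).
replace (x + (y - x)) with y in Hd by ring.
replace (f y - f x) with ((f y - f x) / (y - x) * (y - x)) by (field; lra).
rewrite Rabs_mult; apply Rmult_le_compat_r; [apply Rabs_pos|].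
replace (_ / _) with (((f y - f x) / (y - x) - l) + l) by ring.
eapply Rle_trans; [apply Rabs_triang|lra].
Qed.

(* Up to the shift of the summation index, [Li r th al] is the sum over
   [k >= 1] of [r ^ k * cos (k * th + al) / k ^ 2]: it is the real part of
   [Li_2 (r e^(i th))] for [al = 0] and the imaginary part for
   [al = - (PI / 2)]. [Lg r th al] is likewise the real part of
   [- e^(i al) log (1 - r e^(i th)) / r]. *)
Definition Li (r th al : R) : R :=
  Series (fun k => r ^ S k * cos (INR (S k) * th + al) / INR (S k) ^ 2).

Definition Lg (r th al : R) : R :=
  Series (fun k => r ^ k * cos (INR (S k) * th + al) / INR (S k)).

Lemma ex_series_inv_sq : ex_series (fun k => / INR (S k) ^ 2).
Proof.
apply (ex_series_incr_1 (fun k => / INR (S k) ^ 2)).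
apply (@ex_series_le R_AbsRing R_CompleteNormedModule _
  (fun k => / INR (S k) - / INR (S (S k)))).
- intros k; unfold norm; simpl norm; unfold abs; simpl abs.
  assert (0 < INR (S k)) by (apply lt_0_INR; lia).
  rewrite Rabs_pos_eq.
  + rewrite (S_INR (S k)); generalize dependent (INR (S k)); intros x Hx.
    replace (/ x - / (x + 1)) with (/ (x * (x + 1))) by (field; lra).
    apply Rinv_le_contravar; nra.
  + left; apply Rinv_0_lt_compat, pow_lt, lt_0_INR; lia.
- exists (/ INR 1 - 0).
  apply (is_lim_seq_ext (fun n => / INR 1 - / INR (S (S n)))
    (sum_n (fun k => / INR (S k) - / INR (S (S k)))) (/ INR 1 - 0)).
  + intros n; induction n as [|n IH]; [now rewrite sum_O|].
    rewrite sum_Sn, <- IH; unfold plus; cbn -[INR]; ring.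
  + apply is_lim_seq_minus'; [apply is_lim_seq_const|].
    apply (proj1 (is_lim_seq_incr_1 (fun n => / INR (S n)) 0)).
    apply (proj1 (is_lim_seq_incr_1 (fun n => / INR n) 0)).
    replace (Finite 0) with (Rbar_inv p_infty) by easy.
    apply is_lim_seq_inv; [apply is_lim_seq_INR|easy].
Qed.

Lemma Rabs_Li_term_le (r th al : R) (k : nat) : Rabs r <= 1 ->
  Rabs (r ^ S k * cos (INR (S k) * th + al) / INR (S k) ^ 2)
    <= / INR (S k) ^ 2.
Proof.
intros Hr.
assert (0 < / INR (S k) ^ 2).
{ apply Rinv_0_lt_compat, pow_lt, lt_0_INR; lia. }
unfold Rdiv; rewrite !Rabs_mult, (Rabs_pos_eq (/ _)) by lra.
assert (Rabs (r ^ S k) <= 1).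
{ rewrite <- RPow_abs, <- (pow1 (S k)).
  apply pow_incr; split; [apply Rabs_pos|exact Hr]. }
assert (Rabs (cos (INR (S k) * th + al)) <= 1) by (apply Rabs_le, COS_bound).
pose proof (Rabs_pos (r ^ S k)); pose proof (Rabs_pos (cos (INR (S k) * th + al))).
assert (Rabs (r ^ S k) * Rabs (cos (INR (S k) * th + al)) <= 1) by nra.
nra.
Qed.

Lemma ex_series_Li (r th al : R) : Rabs r <= 1 ->
  ex_series (fun k => r ^ S k * cos (INR (S k) * th + al) / INR (S k) ^ 2).
Proof.
intros Hr.
apply (@ex_series_le R_AbsRing R_CompleteNormedModule _
  (fun k => / INR (S k) ^ 2)); [|apply ex_series_inv_sq].
intros k; now apply Rabs_Li_term_le.
Qed.

(** The majorant [/ INR (S k) ^ 2] is independent of radius and angle, which is why radius 1 is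
    allowed. *)
Lemma continuous_Li (r th : R -> R) (al t : R) :
  continuous r t -> continuous th t ->
  locally t (fun s : R => Rabs (r s) <= 1) ->
  continuous (fun s => Li (r s) (th s) al) t.
Proof.
intros Hr Hth H1.
apply (continuous_Series (fun k s =>
  r s ^ S k * cos (INR (S k) * th s + al) / INR (S k) ^ 2)
  (fun k => / INR (S k) ^ 2)).
- intros k.
  apply (continuous_mult
    (fun s => r s ^ S k * cos (INR (S k) * th s + al)));
    [|apply continuous_const].
  apply (continuous_mult (fun s => r s ^ S k)).
  + apply (continuous_comp r (fun x => x ^ S k)); [exact Hr|].
    apply (ex_derive_continuous (fun x => x ^ S k)); auto_derive; easy.
  + apply (continuous_comp th (fun x => cos (INR (S k) * x + al)));
      [exact Hth|].
    apply (ex_derive_continuous (fun x => cos (INR (S k) * x + al)));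
      auto_derive; easy.
- revert H1; apply filter_imp; intros s Hs k; now apply Rabs_Li_term_le.
- apply ex_series_inv_sq.
Qed.

Lemma ex_series_geom_bounded (a : nat -> R) (q c : R) :
  0 <= q < 1 -> (forall k, Rabs (a k) <= q ^ k * c) -> ex_series a.
Proof.
intros Hq Ha.
apply (@ex_series_le R_AbsRing R_CompleteNormedModule _
  (fun k => q ^ k * c)); [exact Ha|].
apply (ex_series_scal_r c (fun k => q ^ k)), ex_series_geom.
rewrite Rabs_pos_eq; lra.
Qed.

Lemma ex_series_Lg (r th al : R) : Rabs r < 1 ->
  ex_series (fun k => r ^ k * cos (INR (S k) * th + al) / INR (S k)).
Proof.
intros Hr; apply (ex_series_geom_bounded _ (Rabs r) 1).
- split; [apply Rabs_pos|exact Hr].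
- intros k; unfold Rdiv; rewrite !Rabs_mult, <- RPow_abs, Rmult_assoc.
  apply Rmult_le_compat_l; [apply pow_le, Rabs_pos|].
  assert (Rabs (cos (INR (S k) * th + al)) <= 1) by (apply Rabs_le, COS_bound).
  assert (1 <= INR (S k)) by (rewrite S_INR; pose proof (pos_INR k); lra).
  assert (0 < / INR (S k) <= 1).
  { split; [apply Rinv_0_lt_compat; lra|].
    rewrite <- Rinv_1; apply Rinv_le_contravar; lra. }
  rewrite (Rabs_pos_eq (/ _)) by lra.
  pose proof (Rabs_pos (cos (INR (S k) * th + al))); nra.
Qed.

Lemma cos_add_PI2 (x : R) : cos (x + PI / 2) = - sin x.
Proof. rewrite cos_plus, cos_PI2, sin_PI2; ring. Qed.

(** Differentiating in the angle turns cosine into minus sine, that is, shifts the phase by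
    [PI / 2], and leaves one more factor [r] than differentiating in the radius. *)
Lemma is_derive_Li (r th : R -> R) (t r' th' al : R) :
  is_derive r t r' -> is_derive th t th' -> Rabs (r t) < 1 ->
  is_derive (fun s => Li (r s) (th s) al) t
    (r' * Lg (r t) (th t) al + r t * th' * Lg (r t) (th t) (al + PI / 2)).
Proof.
intros Hr Hth H1.
(* [p] lies halfway between the radius and 1, leaving room for the radius to vary; [c] adds local
   Lipschitz constants of [r] and [th]. The majorant is [p ^ k * c]. *)
set (p := (1 + Rabs (r t)) / 2).
set (c := (Rabs r' + 1) + (Rabs th' + 1)).
assert (Hp : 0 <= p < 1) by (unfold p; pose proof (Rabs_pos (r t)); lra).
assert (Hloc : locally t (fun s : R => Rabs (r s) <= p)).
{ assert (Hc : continuous (fun s => Rabs (r s)) t).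
  { apply (continuous_comp r Rabs); [|apply continuous_Rabs].
    apply (ex_derive_continuous r); now exists r'. }
  assert (Hlt : Rabs (r t) < p) by (unfold p; lra).
  generalize (Hc _ (open_lt p _ Hlt)); unfold filtermap.
  apply filter_imp; intros s; lra. }
set (f' := fun k => r' * (r t ^ k * cos (INR (S k) * th t + al) / INR (S k))
  + r t * th' *
    (r t ^ k * cos (INR (S k) * th t + (al + PI / 2)) / INR (S k))).
replace (_ + _) with (Series f').
2:{ unfold f', Lg; rewrite Series_plus, !Series_scal_l; [easy| |];
    apply (ex_series_scal_l _ _ (ex_series_Lg _ _ _ H1)). }
apply (is_derive_Series
  (fun k s => r s ^ S k * cos (INR (S k) * th s + al) / INR (S k) ^ 2) f'
  (fun k => p ^ k * c)).
- intros k; unfold f'.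
  assert (INR (S k) <> 0) by (apply not_0_INR; lia).
  rewrite <- Rplus_assoc, cos_add_PI2.
  auto_derive; [split; [now exists r'|split; [now exists th'|easy]]|].
  replace (Derive (fun x => r x) t) with r' by (symmetry; now apply is_derive_unique).
  replace (Derive (fun x => th x) t) with th' by (symmetry; now apply is_derive_unique).
  change (match k with 0%nat => 1 | S _ => INR k + 1 end) with (INR (S k)).
  simpl pred; simpl pow; field; easy.
- intros k; unfold f'.
  assert (1 <= INR (S k)) by (rewrite S_INR; pose proof (pos_INR k); lra).
  assert (Hi : 0 < / INR (S k) <= 1).
  { split; [apply Rinv_0_lt_compat; lra|].
    rewrite <- Rinv_1; apply Rinv_le_contravar; lra. }
  assert (Hb : forall b, Rabs (r t ^ k * cos b / INR (S k)) <= p ^ k).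
  { intros b; unfold Rdiv; rewrite !Rabs_mult, (Rabs_pos_eq (/ _)) by lra.
    assert (Rabs (cos b) <= 1) by (apply Rabs_le, COS_bound).
    assert (Rabs (r t ^ k) <= p ^ k).
    { rewrite <- RPow_abs; apply pow_incr; unfold p.
      pose proof (Rabs_pos (r t)); lra. }
    pose proof (Rabs_pos (r t ^ k)); pose proof (Rabs_pos (cos b)).
    rewrite Rmult_assoc.
    assert (Rabs (cos b) * / INR (S k) <= 1) by nra.
    assert (0 <= Rabs (cos b) * / INR (S k)) by nra.
    nra. }
  eapply Rle_trans; [apply Rabs_triang|].
  rewrite (Rabs_mult r'), (Rabs_mult (r t * th')), (Rabs_mult (r t)).
  pose proof (Hb (INR (S k) * th t + al)) as B1.
  pose proof (Hb (INR (S k) * th t + (al + PI / 2))) as B2.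
  set (X := Rabs (_ / _)) in *.
  set (Y := Rabs (r t ^ k * cos (_ + (_ + _)) / _)) in *.
  assert (0 <= X) by apply Rabs_pos; assert (0 <= Y) by apply Rabs_pos.
  pose proof (Rabs_pos r'); pose proof (Rabs_pos th'); pose proof (Rabs_pos (r t)).
  assert (Rabs (r t) * Rabs th' <= Rabs th') by nra.
  assert (0 <= Rabs (r t) * Rabs th') by nra.
  unfold c; nra.
- generalize (filter_and _ _ Hloc (filter_and _ _
    (is_derive_locally_lipschitz _ _ _ Hr)
    (is_derive_locally_lipschitz _ _ _ Hth))).
  apply filter_imp; intros s [Hs [Hrs Hths]] k; simpl in s.
  assert (1 <= INR (S k)) by (rewrite S_INR; pose proof (pos_INR k); lra).
  assert (Hrt : Rabs (r t) <= p) by exact (locally_singleton _ _ Hloc).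
  pose proof (Rabs_pow_sub_le (r s) (r t) p k Hs Hrt) as B1.
  pose proof (Rabs_cos_sub_le (INR (S k) * th s + al) (INR (S k) * th t + al))
    as B2.
  replace (_ + al - _) with (INR (S k) * (th s - th t)) in B2 by ring.
  rewrite Rabs_mult, (Rabs_pos_eq (INR (S k))) in B2 by lra.
  set (n := INR (S k)) in *; clearbody n.
  set (u := cos (n * th s + al)) in *; set (v := cos (n * th t + al)) in *.
  assert (Hu : Rabs u <= 1) by (apply Rabs_le, COS_bound).
  clearbody u v.
  replace (_ / _ - _) with
    (((r s ^ S k - r t ^ S k) * u + r t ^ S k * (u - v)) / n ^ 2)
    by (field; lra).
  unfold Rdiv; rewrite Rabs_mult, (Rabs_pos_eq (/ _)).
  2:{ left; apply Rinv_0_lt_compat, pow_lt; lra. }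
  apply (Rmult_le_reg_r (n ^ 2)); [apply pow_lt; lra|].
  rewrite Rmult_assoc, Rinv_l, Rmult_1_r by (apply pow_nonzero; lra).
  eapply Rle_trans; [apply Rabs_triang|]; rewrite !Rabs_mult.
  assert (Ht : Rabs (r t ^ S k) <= p ^ k).
  { rewrite <- RPow_abs.
    apply Rle_trans with (p ^ S k).
    - apply pow_incr; split; [apply Rabs_pos|exact Hrt].
    - simpl; pose proof (pow_le p k (proj1 Hp)); nra. }
  pose proof (pow_le p k (proj1 Hp)) as Hpk.
  set (h := Rabs (s - t)) in *; assert (Hh : 0 <= h) by apply Rabs_pos.
  pose proof (Rabs_pos u); pose proof (Rabs_pos (u - v)).
  pose proof (Rabs_pos (r t ^ S k)); pose proof (Rabs_pos (r s ^ S k - r t ^ S k)).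
  set (a1 := Rabs r' + 1) in *; set (a2 := Rabs th' + 1) in *.
  assert (E1 : Rabs (r s ^ S k - r t ^ S k) * Rabs u <= n * p ^ k * (a1 * h)).
  { apply Rle_trans with (Rabs (r s ^ S k - r t ^ S k) * 1);
      [now apply Rmult_le_compat_l|].
    rewrite Rmult_1_r; eapply Rle_trans; [exact B1|].
    apply Rmult_le_compat_l; [nra|exact Hrs]. }
  assert (E2 : Rabs (r t ^ S k) * Rabs (u - v) <= p ^ k * (n * (a2 * h))).
  { apply Rmult_le_compat; trivial.
    eapply Rle_trans; [exact B2|].
    apply Rmult_le_compat_l; [lra|exact Hths]. }
  assert (0 <= a1 * h) by (pose proof (Rabs_pos (r s - r t)); lra).
  assert (0 <= a2 * h) by (pose proof (Rabs_pos (th s - th t)); lra).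
  unfold c; apply Rle_trans with (p ^ k * ((a1 + a2) * h) * n).
  + nra.
  + rewrite !Rmult_assoc.
    apply Rmult_le_compat_l; [exact Hpk|].
    apply Rle_trans with ((a1 + a2) * h * n * 1); [lra|].
    assert (0 <= (a1 + a2) * h * n) by nra. nra.
- revert Hloc; apply filter_imp; intros s Hs.
  apply ex_series_Li; lra.
- apply (ex_series_geom_bounded _ p c); [exact Hp|].
  intros k; rewrite Rabs_pos_eq; [lra|].
  apply Rmult_le_pos; [apply pow_le, Hp|].
  unfold c; pose proof (Rabs_pos r'); pose proof (Rabs_pos th'); lra.
Qed.

(** * Closed form of the logarithmic series *)

Lemma Rabs_cos_le_1 (x : R) : Rabs (cos x) <= 1.
Proof. apply Rabs_le, COS_bound. Qed.

Lemma one_sub_cos_pos (x th : R) : Rabs x < 1 -> 0 < 1 - x * cos th.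
Proof.
intros Hx.
assert (Rabs (x * cos th) < 1) as H.
{ rewrite Rabs_mult; pose proof (Rabs_cos_le_1 th); pose proof (Rabs_pos x).
  pose proof (Rabs_pos (cos th)); nra. }
apply Rabs_def2 in H; lra.
Qed.

(** This is the squared modulus of [1 - x e^(i th)], whose real part is positive. *)
Lemma norm_sq_pos (x th : R) : Rabs x < 1 -> 0 < 1 - 2 * x * cos th + x ^ 2.
Proof.
intros Hx; pose proof (one_sub_cos_pos x th Hx).
pose proof (sin2_cos2 th) as E; unfold Rsqr in E.
replace (1 - 2 * x * cos th + x ^ 2) with ((1 - x * cos th) ^ 2 + (x * sin th) ^ 2).
- pose proof (pow2_ge_0 (x * sin th)); nra.
- replace (x ^ 2) with (x ^ 2 * (sin th * sin th + cos th * cos th))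
    by (rewrite E; ring).
  ring.
Qed.

(** The characteristic polynomial has roots [x e^(i th)] and [x e^(- i th)]. The recurrence sums the
    geometric series below and later evaluates the numerators of the BBP series. *)
Lemma pow_cos_recurrence (x th al : R) (k : nat) :
  x ^ S (S k) * cos (INR (S (S k)) * th + al)
  = 2 * x * cos th * (x ^ S k * cos (INR (S k) * th + al))
    - x ^ 2 * (x ^ k * cos (INR k * th + al)).
Proof.
replace (INR (S (S k)) * th + al) with ((INR (S k) * th + al) + th)
  by (rewrite (S_INR (S k)); ring).
replace (INR k * th + al) with ((INR (S k) * th + al) - th)
  by (rewrite (S_INR k); ring).
rewrite cos_plus, cos_minus; simpl; ring.
Qed.

Lemma ex_series_pow_cos (x th al : R) : Rabs x < 1 ->
  ex_series (fun k => x ^ k * cos (INR (S k) * th + al)).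
Proof.
intros Hx; apply (ex_series_geom_bounded _ (Rabs x) 1).
- split; [apply Rabs_pos|exact Hx].
- intros k; rewrite Rabs_mult, <- RPow_abs.
  apply Rmult_le_compat_l; [apply pow_le, Rabs_pos|apply Rabs_cos_le_1].
Qed.

(** Real part of [e^(i (th + al)) / (1 - x e^(i th))]. Summing the recurrence over all indices
    yields a linear equation for the sum. *)
Lemma Series_pow_cos (x th al : R) : Rabs x < 1 ->
  Series (fun k => x ^ k * cos (INR (S k) * th + al))
  = (cos (th + al) - x * cos al) / (1 - 2 * x * cos th + x ^ 2).
Proof.
intros Hx; pose proof (norm_sq_pos x th Hx) as HD.
set (a := fun k => x ^ k * cos (INR (S k) * th + al)).
assert (He : ex_series a) by now apply ex_series_pow_cos.
assert (He1 : ex_series (fun k => a (S k))) by now apply (ex_series_incr_1 a).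
assert (Hrec : Series (fun k => a (S (S k)))
  = 2 * x * cos th * Series (fun k => a (S k)) - x ^ 2 * Series a).
{ rewrite <- !Series_scal_l, <- Series_minus.
  - apply Series_ext; intros k; unfold a.
    pose proof (pow_cos_recurrence x th (th + al) k) as E.
    replace (INR (S (S k)) * th + (th + al))
      with (INR (S (S (S k))) * th + al) in E by (rewrite (S_INR (S (S k))); ring).
    replace (INR (S k) * th + (th + al))
      with (INR (S (S k)) * th + al) in E by (rewrite (S_INR (S k)); ring).
    replace (INR k * th + (th + al))
      with (INR (S k) * th + al) in E by (rewrite (S_INR k); ring).
    exact E.
  - now apply (ex_series_scal_l (2 * x * cos th) (fun k => a (S k))).
  - now apply (ex_series_scal_l (x ^ 2) a). }
assert (E1 : Series (fun k => a (S k)) = Series a - cos (th + al)).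
{ rewrite (Series_incr_1 a He).
  replace (a 0%nat) with (cos (th + al)); [ring|].
  unfold a; simpl; now rewrite !Rmult_1_l. }
assert (E2 : Series (fun k => a (S (S k)))
  = Series (fun k => a (S k)) - x * cos (th + th + al)).
{ rewrite (Series_incr_1 (fun k => a (S k)) He1).
  replace (a 1%nat) with (x * cos (th + th + al)); [ring|].
  unfold a; simpl; rewrite Rmult_1_r; do 2 f_equal; ring. }
rewrite E2, E1 in Hrec.
replace (cos (th + th + al)) with (2 * cos th * cos (th + al) - cos al) in Hrec.
2:{ replace (th + th + al) with ((th + al) + th) by ring.
    replace al with ((th + al) - th) at 2 by ring.
    rewrite (cos_plus (th + al) th), (cos_minus (th + al) th); ring. }
fold a; replace (cos (th + al) - x * cos al)
  with (Series a * (1 - 2 * x * cos th + x ^ 2)) by lra.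
field; lra.
Qed.

(* [- log (1 - x e^(i th))] has imaginary part [larg x th]. *)
Definition larg (x th : R) : R := atan (x * sin th / (1 - x * cos th)).

(** Real part of [- e^(i al) log (1 - x e^(i th))]. Both sides vanish at 0, and their derivatives in
    [x] are the geometric series just summed. *)
Lemma Lg_closed (x th al : R) : 0 <= x < 1 ->
  x * Lg x th al
  = - (1 / 2) * ln (1 - 2 * x * cos th + x ^ 2) * cos al
    - larg x th * sin al.
Proof.
intros Hx.
set (F := fun x => Series (fun k => x ^ S k * cos (INR (S k) * th + al) / INR (S k))).
set (C := fun x => - (1 / 2) * ln (1 - 2 * x * cos th + x ^ 2) * cos al
    - atan (x * sin th / (1 - x * cos th)) * sin al).
assert (HF : forall y, Rabs y < 1 -> is_derive F y
  ((cos (th + al) - y * cos al) / (1 - 2 * y * cos th + y ^ 2))).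
{ intros y Hy; rewrite <- Series_pow_cos by exact Hy.
  set (p := (1 + Rabs y) / 2).
  assert (Hp : 0 <= p < 1) by (unfold p; pose proof (Rabs_pos y); lra).
  assert (Hyp : Rabs y < p) by (unfold p; lra).
  assert (Hloc : locally y (fun s : R => Rabs s <= p)).
  { generalize (continuous_Rabs y _ (open_lt p _ Hyp)); unfold filtermap.
    apply filter_imp; intros s; lra. }
  apply (is_derive_Series
    (fun k x => x ^ S k * cos (INR (S k) * th + al) / INR (S k)) _
    (fun k => p ^ k)).
  - intros k; assert (INR (S k) <> 0) by (apply not_0_INR; lia).
    auto_derive; [easy|].
    change (match k with 0%nat => 1 | S _ => INR k + 1 end) with (INR (S k)).
    simpl pred; field; easy.
  - intros k; rewrite Rabs_mult, <- RPow_abs.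
    assert (Rabs y ^ k <= p ^ k)
      by (apply pow_incr; split; [apply Rabs_pos|lra]).
    pose proof (pow_le (Rabs y) k (Rabs_pos y)).
    pose proof (Rabs_pos (cos (INR (S k) * th + al))).
    pose proof (Rabs_cos_le_1 (INR (S k) * th + al)); nra.
  - revert Hloc; apply filter_imp; intros s Hs k; simpl in s.
    assert (1 <= INR (S k)) by (rewrite S_INR; pose proof (pos_INR k); lra).
    pose proof (Rabs_pow_sub_le s y p k Hs ltac:(lra)) as B.
    pose proof (Rabs_cos_le_1 (INR (S k) * th + al)).
    replace (_ / _ - _) with
      ((s ^ S k - y ^ S k) * cos (INR (S k) * th + al) / INR (S k))
      by (field; lra).
    unfold Rdiv; rewrite !Rabs_mult, (Rabs_pos_eq (/ _)).
    2:{ left; apply Rinv_0_lt_compat; lra. }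
    apply (Rmult_le_reg_r (INR (S k))); [lra|].
    rewrite Rmult_assoc, Rinv_l, Rmult_1_r by lra.
    pose proof (Rabs_pos (s ^ S k - y ^ S k)).
    pose proof (Rabs_pos (cos (INR (S k) * th + al))); nra.
  - revert Hloc; apply filter_imp; intros s Hs; simpl in s.
    apply (ex_series_ext
      (fun k => s * (s ^ k * cos (INR (S k) * th + al) / INR (S k)))).
    + intros k; simpl pow; unfold Rdiv; now rewrite !Rmult_assoc.
    + apply (ex_series_scal_l s
        (fun k => s ^ k * cos (INR (S k) * th + al) / INR (S k))).
      apply ex_series_Lg; lra.
  - apply ex_series_geom; rewrite Rabs_pos_eq; lra. }
assert (HC : forall y, Rabs y < 1 -> is_derive C y
  ((cos (th + al) - y * cos al) / (1 - 2 * y * cos th + y ^ 2))).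
{ intros y Hy; unfold C.
  pose proof (norm_sq_pos y th Hy) as HD.
  pose proof (one_sub_cos_pos y th Hy) as H1.
  auto_derive; [split; [simpl in HD; lra|split; [lra|easy]]|].
  rewrite cos_plus; simpl pow in *.
  pose proof (sin2_cos2 th) as E; unfold Rsqr in E.
  set (s := sin th) in *; set (c := cos th) in *; clearbody s c.
  assert (HD' : 0 < (1 - y * c) * (1 - y * c) + (y * s) * (y * s)).
  { pose proof (pow2_ge_0 (y * s)); simpl in *; nra. }
  assert (E2 : 1 - 2 * y * c + y * (y * 1) =
    (1 - y * c) * (1 - y * c) + (y * s) * (y * s)).
  { replace ((y * s) * (y * s)) with (y * y * (s * s)) by ring.
    replace (s * s) with (1 - c * c) by lra; ring. }
  replace (1 + - (2 * y * c) + y * (y * 1))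
    with ((1 - y * c) * (1 - y * c) + y * s * (y * s)) by (rewrite <- E2; ring).
  rewrite E2; field; repeat split; lra. }

assert (E : C 0 - F 0 = C x - F x).
{ apply (constant_on_interval (fun y => C y - F y) 0 x); [lra| |].
  - intros y Hy; apply (ex_derive_continuous (fun y => C y - F y)).
    assert (Rabs y < 1) by (rewrite Rabs_pos_eq; lra).
    eexists; apply (is_derive_minus C F); [now apply HC|now apply HF].
  - intros y Hy; assert (Hy1 : Rabs y < 1) by (rewrite Rabs_pos_eq; lra).
    pose proof (is_derive_minus C F y _ _ (HC y Hy1) (HF y Hy1)) as Hd.
    now rewrite minus_eq_zero in Hd. }
assert (F0 : F 0 = 0).
{ transitivity (0 * Lg 0 th al); [|ring].
  unfold F, Lg; rewrite <- Series_scal_l.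
  apply Series_ext; intros k; simpl pow; unfold Rdiv; ring. }
assert (C0 : C 0 = 0).
{ unfold C; replace (0 * sin th / (1 - 0 * cos th)) with 0 by (field; lra).
  rewrite atan_0.
  replace (1 - 2 * 0 * cos th + 0 ^ 2) with 1 by ring; rewrite ln_1; ring. }
unfold larg.
replace (x * Lg x th al) with (F x).
2:{ unfold F, Lg; rewrite <- Series_scal_l; apply Series_ext.
    intros k; simpl pow; unfold Rdiv; ring. }
change (F x = C x); lra.
Qed.

(** * Real parts on a circle *)

Lemma Lg_0 (r th : R) : 0 <= r < 1 ->
  r * Lg r th 0 = - (1 / 2) * ln (1 - 2 * r * cos th + r ^ 2).
Proof. intros Hr; rewrite Lg_closed, cos_0, sin_0 by exact Hr; ring. Qed.

Lemma Lg_PI2 (r th : R) : 0 <= r < 1 ->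
  r * Lg r th (PI / 2) = - larg r th.
Proof. intros Hr; rewrite Lg_closed, cos_PI2, sin_PI2 by exact Hr; ring. Qed.

Lemma Lg_opp_PI2 (r th : R) : 0 <= r < 1 ->
  r * Lg r th (- (PI / 2)) = larg r th.
Proof.
intros Hr; rewrite Lg_closed, cos_neg, sin_neg, cos_PI2, sin_PI2 by exact Hr.
ring.
Qed.

Lemma is_derive_Li_arc (r : R) (th : R -> R) (t th' : R) : 0 <= r < 1 ->
  is_derive th t th' ->
  is_derive (fun s => Li r (th s) 0) t (- th' * larg r (th t)).
Proof.
intros Hr Hth.
replace (- th' * larg r (th t))
  with (0 * Lg r (th t) 0 + r * th' * Lg r (th t) (0 + PI / 2)).
- apply (is_derive_Li (fun _ => r) th); [apply @is_derive_const|exact Hth|].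
  rewrite Rabs_pos_eq; lra.
- rewrite Rplus_0_l.
  replace (r * th' * Lg r (th t) (PI / 2))
    with (th' * (r * Lg r (th t) (PI / 2))) by ring.
  rewrite Lg_PI2 by exact Hr; ring.
Qed.

Lemma ex_derive_larg (r th : R) : 0 <= r < 1 -> ex_derive (larg r) th.
Proof.
intros Hr; unfold larg.
pose proof (one_sub_cos_pos r th ltac:(rewrite Rabs_pos_eq; lra)).
auto_derive; lra.
Qed.

(* [1 - r e^(i (PI + th + 2 q))] has argument [q], where
   [- q] is the argument of [1 - r e^(i th)]. *)
Lemma larg_reflect (r th : R) : 0 <= r < 1 ->
  larg r (PI + th + 2 * larg r th) = - larg r th.
Proof.
intros Hr.
assert (Hr1 : Rabs r < 1) by (rewrite Rabs_pos_eq; lra).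
set (q := larg r th).
pose proof (one_sub_cos_pos r th Hr1) as H1.
pose proof (one_sub_cos_pos r (PI + th + 2 * q) Hr1) as H2.
assert (Hc : 0 < cos q) by
  (pose proof (atan_bound (r * sin th / (1 - r * cos th)));
   apply cos_gt_0; unfold q, larg; lra).
assert (Ht : sin q * (1 - r * cos th) = r * sin th * cos q).
{ assert (E : tan q = r * sin th / (1 - r * cos th)) by apply tan_atan.
  unfold tan in E; apply (f_equal (fun x => x * (cos q * (1 - r * cos th)))) in E.
  field_simplify in E; [|lra|lra]; lra. }
transitivity (atan (- (r * sin th / (1 - r * cos th)))).
2: now rewrite atan_opp.
unfold larg at 1; f_equal.
apply (Rmult_eq_reg_r ((1 - r * cos (PI + th + 2 * q)) * cos q));
  [|apply Rgt_not_eq; nra].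
replace (r * sin th / (1 - r * cos th)) with (sin q / cos q).
2:{ apply (Rmult_eq_reg_r (cos q * (1 - r * cos th))); [|apply Rgt_not_eq; nra].
    field_simplify; lra. }
field_simplify; [|lra|lra].
replace (PI + th + 2 * q) with (th + q + q + PI) in * by ring.
rewrite neg_sin, neg_cos.
(* Law of sines in the triangle with vertices 0, 1 and [r e^(i th)], whose angle at 1 is [q]. The
   goal is this relation with [th + q] read as [(th + 2 q) - q]. *)
assert (E : r * sin (th + q) = sin q) by (rewrite sin_plus; lra).
replace (r * sin (th + q)) with (r * sin ((th + q + q) - q)) in E
  by (do 2 f_equal; ring).
rewrite sin_minus in E; lra.
Qed.

(* With [a = r e^(i th)] and [b = (r^2 - a) / (1 - a)] one has [|b| = r] and
   [1 - b = (1 - r^2) / (1 - a)], so the derivative in [th] of the sum of the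
   real parts of [Li_2 a] and [Li_2 b] is that of [arg (1 - a) ^ 2]. *)
Lemma Li_arc_sum (r th : R) : 0 <= r < 1 -> 0 <= th ->
  Li r th 0 + Li r (PI + th + 2 * larg r th) 0
  = larg r th ^ 2 + (Li r 0 0 + Li r PI 0).
Proof.
intros Hr Hth.
set (F := fun t => Li r t 0 + Li r (PI + t + 2 * larg r t) 0 - larg r t ^ 2).
assert (HF : forall t, is_derive F t 0).
{ intros t; destruct (ex_derive_larg r t Hr) as [q' Hq].
  pose proof (is_derive_Li_arc r (fun s => s) t 1 Hr (is_derive_id t)) as D1.
  assert (D2 : is_derive (fun s => PI + s + 2 * larg r s) t (1 + 2 * q')).
  { auto_derive; [now exists q'|].
    replace (Derive (fun x => larg r x) t) with q'
      by (symmetry; now apply is_derive_unique).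
    ring. }
  apply (is_derive_Li_arc r _ t _ Hr) in D2; cbv beta in D2.
  rewrite larg_reflect in D2 by exact Hr.
  assert (D3 : is_derive (fun s => larg r s ^ 2) t (2 * q' * larg r t)).
  { auto_derive; [now exists q'|].
    replace (Derive (fun x => larg r x) t) with q'
      by (symmetry; now apply is_derive_unique).
    ring. }
  pose proof (is_derive_minus _ _ _ _ _ (is_derive_plus _ _ _ _ _ D1 D2) D3) as D.
  unfold minus, plus, opp in D; simpl in D.
  replace 0 with (- (1) * larg r t + - (1 + 2 * q') * - larg r t
    + - (2 * q' * larg r t)) by ring.
  exact D. }
(* At argument 0 the involution sends [r] to [- r], which produces the constant with arguments 0 and
   [PI]. *)
assert (E : F 0 = F th).
{ apply constant_on_interval; [exact Hth| |]; intros x _; [|apply HF].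
  apply (ex_derive_continuous F); exists 0; apply HF. }
unfold F in E.
assert (E0 : larg r 0 = 0).
{ unfold larg; rewrite sin_0, Rmult_0_r; unfold Rdiv; now rewrite Rmult_0_l, atan_0. }
rewrite E0 in E; replace (PI + 0 + 2 * 0) with PI in E by ring; simpl pow in *; lra.
Qed.

(** * The inverse tangent integral and Catalan's constant *)

Lemma sum_n_add_S (a : nat -> R) (k p : nat) :
  sum_n a (k + S p) = sum_n a k + sum_n (fun j => a (S k + j)%nat) p.
Proof.
induction p as [|p IH].
- rewrite sum_O, !Nat.add_0_r, Nat.add_1_r, sum_Sn; reflexivity.
- rewrite (Nat.add_succ_r k (S p)), !sum_Sn, IH.
  unfold plus; cbn -[sum_n]; rewrite Rplus_assoc; do 3 f_equal; lia.
Qed.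

(** The partial sums of the grouped series form a subsequence of those of [a]. As [sum_n] includes
    its upper index, a block has [S p] terms. *)
Lemma is_series_blocks (a : nat -> R) (p : nat) (l : R) :
  is_series a l ->
  is_series (fun m => sum_n (fun j => a (j + m * S p)%nat) p) l.
Proof.
intros H.
apply (is_lim_seq_ext (fun m => sum_n a (m * S p + p)) _ l).
- intros m; induction m as [|m IH].
  + rewrite sum_O; apply sum_n_ext; intros j; f_equal; lia.
  + rewrite sum_Sn, <- IH.
    replace (S m * S p + p)%nat with (m * S p + p + S p)%nat by lia.
    rewrite sum_n_add_S; unfold plus; cbn -[sum_n]; f_equal.
    apply sum_n_ext; intros j; f_equal; lia.
- apply (is_lim_seq_subseq (sum_n a) l); [|exact H].
  apply eventually_subseq; intros n; lia.
Qed.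

Lemma cos_INR_PI (m : nat) : cos (INR m * PI) = (-1) ^ m.
Proof.
induction m as [|m IH]; [simpl; rewrite Rmult_0_l; apply cos_0|].
replace (INR (S m) * PI) with (INR m * PI + PI) by (rewrite S_INR; ring).
rewrite neg_cos, IH; simpl; ring.
Qed.

(** Terms are grouped in pairs: an odd exponent [2 m + 1] gives [cos (m PI)], and the even exponent
    after it gives 0. *)
Lemma Li_Catalan : Li 1 (PI / 2) (- (PI / 2)) = Catalan.
Proof.
pose proof (Series_correct _ (ex_series_Li 1 (PI / 2) (- (PI / 2))
  ltac:(rewrite Rabs_R1; lra))) as H.
apply (is_series_blocks _ 1) in H; apply is_series_unique in H.
unfold Li; rewrite <- H; apply Series_ext; intros m.
rewrite sum_Sn, sum_O; unfold plus; cbn -[INR pow].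
rewrite !pow1.
replace (INR (S (m * 2)) * (PI / 2) + - (PI / 2)) with (INR m * PI)
  by (rewrite S_INR, mult_INR; simpl; field).
replace (INR (S (S (m * 2))) * (PI / 2) + - (PI / 2)) with (INR m * PI + PI / 2)
  by (rewrite !S_INR, mult_INR; simpl; field).
rewrite cos_add_PI2, cos_INR_PI.
assert (E : sin (INR m * PI) = 0).
{ apply sin_eq_0_1; exists (Z.of_nat m); now rewrite <- INR_IZR_INZ. }
rewrite E, S_INR, mult_INR; simpl (INR 2).
replace (INR m * (1 + 1) + 1) with (2 * INR m + 1) by ring.
unfold Rdiv; ring.
Qed.

(* The inverse tangent integral, made constant beyond [1] so that it is
   continuous there. *)
Definition Ti (t : R) : R := Li (Rmin t 1) (PI / 2) (- (PI / 2)).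

Lemma Li_0_l (th al : R) : Li 0 th al = 0.
Proof.
transitivity (0 * Series (fun _ => 0)); [|ring].
unfold Li; rewrite <- Series_scal_l.
apply Series_ext; intros k; simpl pow; unfold Rdiv; ring.
Qed.

Lemma Ti_0 : Ti 0 = 0.
Proof. unfold Ti; rewrite Rmin_left by lra; apply Li_0_l. Qed.

Lemma Ti_1 : Ti 1 = Catalan.
Proof. unfold Ti; rewrite Rmin_left by lra; apply Li_Catalan. Qed.

Lemma continuous_Ti (t : R) : 0 <= t -> continuous Ti t.
Proof.
intros Ht; unfold Ti; apply (continuous_Li (fun s => Rmin s 1) (fun _ => PI / 2)).
- apply (continuous_ext (fun s => (s + 1 - Rabs (s - 1)) / 2)).
  + intros s; unfold Rmin, Rabs; destruct (Rle_dec s 1), (Rcase_abs (s - 1)); simpl; lra.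
  + apply continuity_pt_filterlim; reg.
- apply continuous_const.
- assert (H : -1 < t) by lra.
  generalize (open_gt _ _ H); apply filter_imp; intros s Hs; simpl in s.
  apply Rabs_le; unfold Rmin; destruct (Rle_dec s 1); lra.
Qed.

Lemma is_derive_Ti (t : R) : 0 < t < 1 -> is_derive Ti t (atan t / t).
Proof.
intros Ht.
apply (is_derive_ext_loc (fun s => Li s (PI / 2) (- (PI / 2)))).
- assert (H : t < 1) by lra.
  generalize (open_lt _ _ H); apply filter_imp; intros s Hs; simpl in s.
  unfold Ti; now rewrite Rmin_left by lra.
- pose proof (is_derive_Li (fun s => s) (fun _ => PI / 2) t 1 0 (- (PI / 2))
    (is_derive_id t) (is_derive_const _ _) ltac:(rewrite Rabs_pos_eq; lra)) as D.
  cbv beta in D.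
  pose proof (Lg_opp_PI2 t (PI / 2) ltac:(lra)) as E.
  unfold larg in E; rewrite cos_PI2, sin_PI2 in E.
  replace (t * 1 / (1 - t * 0)) with t in E by field.
  replace (atan t / t) with (1 * Lg t (PI / 2) (- (PI / 2))
    + t * 0 * Lg t (PI / 2) (- (PI / 2) + PI / 2)); [exact D|].
  rewrite <- E; field; lra.
Qed.

(** With [t = tan u], the differential [atan t / t dt] is [2 u / sin (2 u) du]; in this form the
    cosecant identity below applies. *)
Lemma is_derive_Ti_tan (u : R -> R) (x u' : R) :
  is_derive u x u' -> 0 < u x < PI / 4 ->
  is_derive (fun s => Ti (tan (u s))) x (u' * (2 * u x / sin (2 * u x))).
Proof.
intros Hu Hx; pose proof PI_RGT_0.
assert (Hc : 0 < cos (u x)) by (apply cos_gt_0; lra).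
assert (Hs : 0 < sin (u x)) by (apply sin_gt_0; lra).
assert (Ht : 0 < tan (u x) < 1).
{ split; [apply tan_gt_0; lra|].
  rewrite <- tan_PI4; apply tan_increasing; lra. }
pose proof (is_derive_comp tan u x _ _ (is_derive_tan (u x) ltac:(lra)) Hu) as D.
apply (is_derive_comp Ti (fun s => tan (u s)) x _ _ (is_derive_Ti _ Ht)) in D.
unfold scal in D; simpl in D; unfold mult in D; simpl in D.
replace (u' * (2 * u x / sin (2 * u x))) with
  (u' * (tan (u x) ^ 2 + 1) * (atan (tan (u x)) / tan (u x))); [exact D|].
rewrite atan_tan, sin_2a by lra; unfold tan.
pose proof (sin2_cos2 (u x)) as E; unfold Rsqr in E.
replace ((sin (u x) / cos (u x)) ^ 2 + 1) with (/ (cos (u x)) ^ 2).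
- field; lra.
- apply (Rmult_eq_reg_r (cos (u x) ^ 2)); [|apply pow_nonzero; lra].
  field_simplify; [|lra|lra]; simpl; lra.
Qed.

Lemma continuous_tan_comp (u : R -> R) (x : R) :
  continuous u x -> - (PI / 2) < u x < PI / 2 ->
  continuous (fun s => tan (u s)) x.
Proof.
intros Hu Hx; apply (continuous_comp u tan); [exact Hu|].
apply (ex_derive_continuous tan); eexists; apply is_derive_tan.
apply Rgt_not_eq, cos_gt_0; lra.
Qed.

Lemma continuous_Ti_tan (u : R -> R) (x : R) :
  continuous u x -> 0 <= u x < PI / 2 ->
  continuous (fun s => Ti (tan (u s))) x.
Proof.
intros Hu Hx; apply (continuous_comp (fun s => tan (u s)) Ti).
- apply continuous_tan_comp; [exact Hu|lra].
- apply continuous_Ti; destruct (Req_dec (u x) 0) as [->|N].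
  + rewrite tan_0; lra.
  + left; apply tan_gt_0; lra.
Qed.

Lemma is_derive_ln_tan (u : R -> R) (x u' : R) :
  is_derive u x u' -> 0 < u x < PI / 2 ->
  is_derive (fun s => ln (tan (u s))) x (u' * (2 / sin (2 * u x))).
Proof.
intros Hu Hx; pose proof PI_RGT_0.
assert (Hc : 0 < cos (u x)) by (apply cos_gt_0; lra).
assert (Hs : 0 < sin (u x)) by (apply sin_gt_0; lra).
assert (Ht : 0 < tan (u x)) by (apply tan_gt_0; lra).
pose proof (is_derive_comp tan u x _ _ (is_derive_tan (u x) ltac:(lra)) Hu) as D.
apply (is_derive_comp ln (fun s => tan (u s)) x _ _ (is_derive_ln _ Ht)) in D.
unfold scal in D; simpl in D; unfold mult in D; simpl in D.
replace (u' * (2 / sin (2 * u x))) with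
  (u' * (tan (u x) ^ 2 + 1) * / tan (u x)); [exact D|].
rewrite sin_2a; unfold tan.
pose proof (sin2_cos2 (u x)) as E; unfold Rsqr in E.
replace ((sin (u x) / cos (u x)) ^ 2 + 1) with (/ (cos (u x)) ^ 2).
- field; lra.
- apply (Rmult_eq_reg_r (cos (u x) ^ 2)); [|apply pow_nonzero; lra].
  field_simplify; [|lra|lra]; simpl; lra.
Qed.

(** At [x = 2 u] this is half the logarithmic derivative in [u] of [tan (3 u) = tan u * tan (PI / 3
    - u) * tan (PI / 3 + u)]. The proof rests on [sin (3 x) = 4 sin x sin (PI / 3 - x) sin (PI / 3 +
    x)]. *)
Lemma csc_triple (x : R) : 0 < x < PI / 3 ->
  3 / sin (3 * x) = / sin x + / sin (PI / 3 - x) - / sin (PI / 3 + x).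
Proof.
intros Hx; pose proof PI_RGT_0.
assert (H0 : 0 < sin x) by (apply sin_gt_0; lra).
assert (H1 : 0 < sin (PI / 3 - x)) by (apply sin_gt_0; lra).
assert (H2 : 0 < sin (PI / 3 + x)) by (apply sin_gt_0; lra).
assert (E3 : sin (3 * x) = 4 * sin x * (sin (PI / 3 - x) * sin (PI / 3 + x))).
{ rewrite sin_minus, sin_plus, sin_PI3, cos_PI3.
  replace (3 * x) with (2 * x + x) by ring; rewrite sin_plus, sin_2a, cos_2a.
  pose proof (sin2_cos2 x) as E; unfold Rsqr in E.
  pose proof (sqrt_sqrt 3 ltac:(lra)) as E'.
  set (s := sin x) in *; set (c := cos x) in *; set (w := sqrt 3) in *.
  transitivity (s * (3 * (c * c) - s * s)); [ring|].
  transitivity (s * (w * w * (c * c) - s * s)); [rewrite E'; ring|field]. }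
assert (Ed : sin (PI / 3 + x) - sin (PI / 3 - x) = sin x).
{ rewrite sin_minus, sin_plus, sin_PI3, cos_PI3; field. }
assert (Ep : 4 * (sin (PI / 3 - x) * sin (PI / 3 + x)) = 3 - 4 * (sin x * sin x)).
{ rewrite sin_minus, sin_plus, sin_PI3, cos_PI3.
  pose proof (sin2_cos2 x) as E; unfold Rsqr in E.
  pose proof (sqrt_sqrt 3 ltac:(lra)) as E'.
  set (s := sin x) in *; set (c := cos x) in *; set (w := sqrt 3) in *.
  transitivity (w * w * (c * c) - s * s); [field|].
  rewrite E'; replace (c * c) with (1 - s * s) by lra; ring. }
rewrite E3.
set (s := sin x) in *; set (a := sin (PI / 3 - x)) in *;
  set (b := sin (PI / 3 + x)) in *; clearbody s a b.
pose proof (Rmult_lt_0_compat _ _ H0 (Rmult_lt_0_compat _ _ H1 H2)).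
apply (Rmult_eq_reg_r (4 * s * (a * b))); [|lra].
field_simplify; [|lra|lra].
assert (b = a + s) as -> by lra; lra.
Qed.

(* [tan (3 x) = tan x * tan (PI / 3 - x) * tan (PI / 3 + x)] makes the
   derivative of the combination below vanish on [0, PI / 12]; it is
   [0] at [0]. *)
Lemma Ti_tan_PI12 :
  Ti (tan (PI / 12)) - PI / 12 * ln (tan (PI / 12)) = 2 / 3 * Catalan.
Proof.
pose proof PI_RGT_0.
(* The logarithms remove the constant part [PI / 3] of the numerators [PI / 3 - 2 x] and
   [PI / 3 + 2 x]; what remains is [2 x] times a combination that vanishes by [csc_triple]. At
   [PI / 12], both [tan (3 x)] and [tan (PI / 6 + x)] equal 1. *)
set (K := fun x => Ti (tan (3 * x)) / 3 - Ti (tan x) - Ti (tan (PI / 6 - x))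
  + Ti (tan (PI / 6 + x))
  + PI / 6 * (ln (tan (PI / 6 - x)) - ln (tan (PI / 6 + x)))).
assert (E : K 0 = K (PI / 12)).
{ assert (L : forall a b x : R, is_derive (fun y => a + b * y) x b).
  { intros a b x; auto_derive; [easy|ring]. }
  assert (D3 : forall x, is_derive (fun y => 3 * y) x 3).
  { intros x; auto_derive; [easy|ring]. }
  assert (D1 : forall x : R, is_derive (fun y => y) x 1) by exact is_derive_id.
  assert (Dm : forall x, is_derive (fun y => PI / 6 - y) x (-1)).
  { intros x; auto_derive; [easy|ring]. }
  assert (Dp : forall x, is_derive (fun y => PI / 6 + y) x 1).
  { intros x; auto_derive; [easy|ring]. }
  clear L.
  assert (C : forall (u : R -> R) x l, is_derive u x l -> continuous u x).
  { intros u x l Hu; apply (ex_derive_continuous u); now exists l. }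
  apply constant_on_interval; [lra| |]; intros x Hx.
  - unfold K.
    apply (continuous_plus (V := R_NormedModule)).
    apply (continuous_plus (V := R_NormedModule)).
    apply (continuous_minus (V := R_NormedModule)).
    apply (continuous_minus (V := R_NormedModule)).
    + apply (continuous_mult (fun x => Ti (tan (3 * x)))); [|apply continuous_const].
      apply continuous_Ti_tan; [eapply C, D3|lra].
    + apply (continuous_Ti_tan (fun y => y)); [eapply C, D1|lra].
    + apply continuous_Ti_tan; [eapply C, Dm|lra].
    + apply continuous_Ti_tan; [eapply C, Dp|lra].
    + apply (continuous_mult (fun _ => PI / 6)); [apply continuous_const|].
      apply (continuous_minus (V := R_NormedModule)).
      * eapply C, is_derive_ln_tan; [apply Dm|lra].
      * eapply C, is_derive_ln_tan; [apply Dp|lra].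
  - pose proof (is_derive_Ti_tan _ _ _ (D3 x) ltac:(lra)) as T3.
    pose proof (is_derive_Ti_tan _ _ _ (D1 x) ltac:(lra)) as T1.
    pose proof (is_derive_Ti_tan _ _ _ (Dm x) ltac:(lra)) as Tm.
    pose proof (is_derive_Ti_tan _ _ _ (Dp x) ltac:(lra)) as Tp.
    pose proof (is_derive_ln_tan _ _ _ (Dm x) ltac:(lra)) as Lm.
    pose proof (is_derive_ln_tan _ _ _ (Dp x) ltac:(lra)) as Lp.
    apply (is_derive_scal_l _ _ _ (/ 3)) in T3.
    pose proof (is_derive_scal _ _ (PI / 6) _ (is_derive_minus _ _ _ _ _ Lm Lp)) as Lg'.
    pose proof (is_derive_plus _ _ _ _ _ (is_derive_plus _ _ _ _ _
      (is_derive_minus _ _ _ _ _ (is_derive_minus _ _ _ _ _ T3 T1) Tm) Tp) Lg')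
      as D.
    unfold minus, plus, opp, scal in D; simpl in D; unfold mult in D; simpl in D.
    unfold K, Rdiv, Rminus in *.
    pose proof (csc_triple (2 * x) ltac:(lra)) as Q.
    replace (2 * (PI * / 6 + x)) with (PI / 3 + 2 * x) in D by field.
    replace (2 * (PI * / 6 + - x)) with (PI / 3 - 2 * x) in D by field.
    replace (2 * (3 * x)) with (3 * (2 * x)) in D by ring.
    match type of D with is_derive _ _ ?d => replace 0 with d; [exact D|] end.
    unfold Rdiv in Q.
    transitivity (2 * x * (3 * / sin (3 * (2 * x)) - (/ sin (2 * x)
      + / sin (PI * / 3 - 2 * x) - / sin (PI * / 3 + 2 * x)))); [|rewrite Q; ring].
    unfold Rdiv, Rminus.
    set (a := PI * / 3); generalize (/ sin (3 * (2 * x))) (/ sin (2 * x))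
      (/ sin (a + - (2 * x))) (/ sin (a + 2 * x)).
    unfold a; intros; field. }
unfold K in E.
replace (3 * 0) with 0 in E by ring.
replace (3 * (PI / 12)) with (PI / 4) in E by field.
replace (PI / 6 - 0) with (PI / 6) in E by ring.
replace (PI / 6 + 0) with (PI / 6) in E by ring.
replace (PI / 6 - PI / 12) with (PI / 12) in E by field.
replace (PI / 6 + PI / 12) with (PI / 4) in E by field.
rewrite tan_0, tan_PI4, Ti_0, Ti_1, ln_1 in E; lra.
Qed.

Lemma cos_sub_sin_PI12 : cos (PI / 12) - sin (PI / 12) = / sqrt 2.
Proof.
pose proof (cos_plus (PI / 12) (PI / 4)) as E.
replace (PI / 12 + PI / 4) with (PI / 3) in E by field.
rewrite cos_PI3, cos_PI4, sin_PI4 in E.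
pose proof (sqrt_sqrt 2 ltac:(lra)); pose proof (sqrt_lt_R0 2 ltac:(lra)).
apply (Rmult_eq_reg_r (1 / sqrt 2)); [|apply Rgt_not_eq; apply Rdiv_lt_0_compat; lra].
transitivity (1 / 2); [rewrite E; ring|].
replace (1 / 2) with (1 / (sqrt 2 * sqrt 2)) by (f_equal; lra); field; lra.
Qed.

(* With [t = tan u], the points [(1 - t) / (1 - i t)] and
   [i (1 - t) / (1 - i t)] have modulus [cos u - sin u] and arguments [u] and
   [u + PI / 2]; their distances to [1] have quotient [t], and [1 - z] has
   the same argument for both, so that the derivative of the difference of
   the imaginary parts of [Li_2] is [ln (tan u)]. *)
Lemma Li_im_PI12 :
  Li (/ sqrt 2) (7 * PI / 12) (- (PI / 2)) - Li (/ sqrt 2) (PI / 12) (- (PI / 2))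
  = Catalan / 3.
Proof.
pose proof PI_RGT_0.
set (r := fun u => cos u - sin u).
(* [u * ln (tan u) - Ti (tan u)] is an antiderivative of [ln (tan u)]. At [PI / 4] the radius is 0
   and only [Ti 1] survives; at [PI / 12] the radius is [/ sqrt 2] and [Ti_tan_PI12] applies. *)
set (F := fun u => Li (r u) (u + PI / 2) (- (PI / 2)) - Li (r u) u (- (PI / 2))
  - (u * ln (tan u) - Ti (tan u))).
assert (Hr : forall u, PI / 12 <= u <= PI / 4 -> 0 <= r u < 1).
{ intros u Hu; unfold r.
  assert (cos (PI / 4) <= cos u) by (apply cos_decr_1; lra).
  assert (sin u <= sin (PI / 4)) by (apply sin_incr_1; lra).
  assert (0 < sin u) by (apply sin_gt_0; lra).
  pose proof (COS_bound u); rewrite cos_PI4, sin_PI4 in *; lra. }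
assert (Dr : forall u, is_derive r u (- (sin u + cos u))).
{ intros u; unfold r; auto_derive; [easy|ring]. }
assert (D1 : forall u : R, is_derive (fun v : R => v) u 1) by exact is_derive_id.
assert (Dp : forall u, is_derive (fun v => v + PI / 2) u 1).
{ intros u; auto_derive; [easy|ring]. }
assert (DB : forall u, PI / 12 <= u <= PI / 4 ->
  is_derive (fun v => Li (r v) v (- (PI / 2))) u
    (- (sin u + cos u) * Lg (r u) u (- (PI / 2)) + r u * 1 * Lg (r u) u 0)).
{ intros u Hu; rewrite <- (Rplus_opp_l (PI / 2)).
  apply (is_derive_Li r (fun v => v)); [apply Dr|apply D1|].
  rewrite Rabs_pos_eq; apply Hr, Hu. }
assert (DA : forall u, PI / 12 <= u <= PI / 4 ->
  is_derive (fun v => Li (r v) (v + PI / 2) (- (PI / 2))) u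
    (- (sin u + cos u) * Lg (r u) (u + PI / 2) (- (PI / 2))
     + r u * 1 * Lg (r u) (u + PI / 2) 0)).
{ intros u Hu; rewrite <- (Rplus_opp_l (PI / 2)).
  apply (is_derive_Li r (fun v => v + PI / 2)); [apply Dr|apply Dp|].
  rewrite Rabs_pos_eq; apply Hr, Hu. }
assert (DL : forall u, PI / 12 <= u <= PI / 4 ->
  is_derive (fun v => v * ln (tan v)) u
    (ln (tan u) + u * (2 / sin (2 * u)))).
{ intros u Hu.
  pose proof (is_derive_ln_tan (fun v => v) u 1 (D1 u) ltac:(lra)) as D.
  pose proof (is_derive_mult (fun v => v) _ u _ _ (D1 u) D Rmult_comm) as D'.
  unfold plus, mult in D'; simpl in D'.
  replace (ln (tan u) + u * (2 / sin (2 * u)))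
    with (1 * ln (tan u) + u * (1 * (2 / sin (2 * u)))) by ring.
  exact D'. }
assert (C : forall (u : R -> R) x l, is_derive u x l -> continuous u x).
{ intros u x l Hu; apply (ex_derive_continuous u); now exists l. }
assert (E : F (PI / 12) = F (PI / 4)).
{ apply constant_on_interval; [lra| |]; intros u Hu.
  - unfold F.
    apply (continuous_minus (V := R_NormedModule)).
    apply (continuous_minus (V := R_NormedModule)).
    + eapply C, DA, Hu.
    + eapply C, DB, Hu.
    + apply (continuous_minus (V := R_NormedModule)).
      * eapply C, DL, Hu.
      * apply (continuous_Ti_tan (fun v => v)); [eapply C, D1|lra].
  - assert (Hu' : PI / 12 <= u <= PI / 4) by lra.
    pose proof (is_derive_Ti_tan (fun v => v) u 1 (D1 u) ltac:(lra)) as DT.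
    pose proof (is_derive_minus _ _ _ _ _
      (is_derive_minus _ _ _ _ _ (DA u Hu') (DB u Hu'))
      (is_derive_minus _ _ _ _ _ (DL u Hu') DT)) as D.
    unfold minus, plus, opp in D; simpl in D.
    match type of D with is_derive _ _ ?d => replace 0 with d; [exact D|] end.
    pose proof (Hr u Hu') as Hru.
    assert (Hs : 0 < sin u) by (apply sin_gt_0; lra).
    assert (Hsc : sin u < cos u).
    { rewrite <- cos_shift.
      apply cos_decreasing_1; lra. }
    pose proof (sin2_cos2 u) as E2; unfold Rsqr in E2.
    assert (Esin : sin (u + PI / 2) = cos u).
    { rewrite sin_plus, cos_PI2, sin_PI2; ring. }
    assert (EL : larg (r u) (u + PI / 2) = larg (r u) u).
    { unfold larg; f_equal; rewrite Esin, cos_add_PI2; unfold r.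
      replace (1 - (cos u - sin u) * - sin u)
        with (cos u * (cos u + sin u)) by lra.
      replace (1 - (cos u - sin u) * cos u)
        with (sin u * (cos u + sin u)) by lra.
      field; lra. }
    assert (EA : Lg (r u) (u + PI / 2) (- (PI / 2)) = Lg (r u) u (- (PI / 2))).
    { apply (Rmult_eq_reg_l (r u)); [|unfold r; lra].
      rewrite !Lg_opp_PI2 by lra; exact EL. }
    rewrite EA, !Rmult_1_r, !Lg_0 by lra.
    rewrite cos_add_PI2.
    replace (1 - 2 * r u * - sin u + r u ^ 2) with (2 * (cos u) ^ 2)
      by (unfold r; lra).
    replace (1 - 2 * r u * cos u + r u ^ 2) with (2 * (sin u) ^ 2)
      by (unfold r; lra).
    unfold tan; rewrite ln_div, !ln_mult, !ln_pow; try lra;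
      try (apply pow_lt; lra).
    simpl INR; unfold Rdiv; generalize (/ sin (2 * u)); intros; field. }
unfold F in E.
replace (r (PI / 4)) with 0 in E by (unfold r; rewrite cos_PI4, sin_PI4; ring).
replace (r (PI / 12)) with (/ sqrt 2) in E
  by (symmetry; exact cos_sub_sin_PI12).
rewrite !Li_0_l, tan_PI4, ln_1, Ti_1 in E.
replace (PI / 12 + PI / 2) with (7 * PI / 12) in E by field.
pose proof Ti_tan_PI12; lra.
Qed.

(** * The BBP-type formula *)

Lemma inv_sqrt2_sq : / sqrt 2 * / sqrt 2 = 1 / 2.
Proof.
pose proof (sqrt_sqrt 2 ltac:(lra)) as E; pose proof (sqrt_lt_R0 2 ltac:(lra)).
rewrite <- Rinv_mult, E; field.
Qed.

Lemma inv_sqrt2_bounds : 0 <= / sqrt 2 < 1.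
Proof.
assert (0 < / sqrt 2) by (apply Rinv_0_lt_compat, sqrt_lt_R0; lra).
pose proof inv_sqrt2_sq; split; [lra|nra].
Qed.

Lemma inv_sqrt2_cos_sin_PI12 :
  / sqrt 2 * cos (PI / 12) = (1 + sqrt 3) / 4 /\
  / sqrt 2 * sin (PI / 12) = (sqrt 3 - 1) / 4.
Proof.
pose proof inv_sqrt2_sq as E.
replace (PI / 12) with (PI / 3 - PI / 4) by field.
rewrite cos_minus, sin_minus, cos_PI3, sin_PI3, cos_PI4, sin_PI4.
unfold Rdiv; rewrite !Rmult_1_l; set (y := / sqrt 2) in *; clearbody y.
split.
- transitivity (y * y * (1 + sqrt 3) / 2); [field|rewrite E; field].
- transitivity (y * y * (sqrt 3 - 1) / 2); [field|rewrite E; field].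
Qed.

Lemma Li_reflect (r th : R) : Li r (2 * PI - th) 0 = Li r th 0.
Proof.
unfold Li; apply Series_ext; intros k; do 2 f_equal.
replace (INR (S k) * (2 * PI - th) + 0)
  with (- (INR (S k) * th + 0) + 2 * INR (S k) * PI) by ring.
now rewrite cos_period, cos_neg.
Qed.

Lemma atan_inv_sqrt3 : atan (1 / sqrt 3) = PI / 6.
Proof. pose proof PI_RGT_0; rewrite <- tan_PI6; apply atan_tan; lra. Qed.

Lemma larg_PI4 : larg (/ sqrt 2) (PI / 4) = PI / 4.
Proof.
unfold larg; rewrite sin_PI4, cos_PI4.
replace (/ sqrt 2 * (1 / sqrt 2)) with (1 / 2)
  by (rewrite <- inv_sqrt2_sq; unfold Rdiv; ring).
replace (1 / 2 / (1 - 1 / 2)) with 1 by field; apply atan_1.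
Qed.

Lemma larg_PI3 : larg (1 / 2) (PI / 3) = PI / 6.
Proof.
unfold larg; rewrite sin_PI3, cos_PI3, <- atan_inv_sqrt3; f_equal.
pose proof (sqrt_sqrt 3 ltac:(lra)); pose proof (sqrt_lt_R0 3 ltac:(lra)).
apply (Rmult_eq_reg_r (sqrt 3)); [|lra].
field_simplify; [|lra]. simpl; lra.
Qed.

Lemma larg_PI12 : larg (/ sqrt 2) (PI / 12) = PI / 6.
Proof.
unfold larg; destruct inv_sqrt2_cos_sin_PI12 as [-> ->].
rewrite <- atan_inv_sqrt3; f_equal.
pose proof (sqrt_sqrt 3 ltac:(lra)); pose proof (sqrt_lt_R0 3 ltac:(lra)).
assert (sqrt 3 < 3) by nra.
apply (Rmult_eq_reg_r (sqrt 3 * (1 - (1 + sqrt 3) / 4))); [|nra].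
field_simplify; try lra.
Qed.

(** The involution sends the points at [PI / 4] and [PI / 3] to their conjugates, and the one at
    [PI / 12] to the conjugate of the one at [7 PI / 12]. The squared arguments contribute
    [3 PI^2 / 16], [PI^2 / 16] and [- PI^2 / 4], which add up to 0; the weights also cancel the
    values at arguments 0 and [PI]. *)
Lemma Catalan_Li :
  Catalan
  = 6 * (Li (/ sqrt 2) 0 0 + Li (/ sqrt 2) PI 0) + 6 * Li (/ sqrt 2) (PI / 4) 0
    - 9 * (Li (/ sqrt 2) (PI / 12) 0 + Li (/ sqrt 2) (7 * PI / 12) 0)
    + 3 * (Li (/ sqrt 2) (7 * PI / 12) (- (PI / 2))
           - Li (/ sqrt 2) (PI / 12) (- (PI / 2)))
    - 9 / 4 * (Li (1 / 2) 0 0 + Li (1 / 2) PI 0)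
    + 9 / 2 * Li (1 / 2) (PI / 3) 0.
Proof.
pose proof PI_RGT_0; pose proof inv_sqrt2_bounds.
pose proof (Li_arc_sum (/ sqrt 2) (PI / 4) ltac:(lra) ltac:(lra)) as E4.
pose proof (Li_arc_sum (/ sqrt 2) (PI / 12) ltac:(lra) ltac:(lra)) as E12.
pose proof (Li_arc_sum (1 / 2) (PI / 3) ltac:(lra) ltac:(lra)) as E3.
rewrite larg_PI4 in E4; rewrite larg_PI12 in E12; rewrite larg_PI3 in E3.
replace (PI + PI / 4 + 2 * (PI / 4)) with (2 * PI - PI / 4) in E4 by field.
replace (PI + PI / 12 + 2 * (PI / 6)) with (2 * PI - 7 * PI / 12) in E12 by field.
replace (PI + PI / 3 + 2 * (PI / 6)) with (2 * PI - PI / 3) in E3 by field.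
rewrite Li_reflect in E4, E12, E3.
pose proof Li_im_PI12; lra.
Qed.

(* The numerators at [k] of the series with ratio [1 / sqrt 2], respectively
   [1 / 2], on the right hand side of [Catalan_Li]. *)
Definition num24 (k : nat) : R :=
  let c th al := (/ sqrt 2) ^ k * cos (INR k * th + al) in
  6 * (c 0 0 + c PI 0) + 6 * c (PI / 4) 0
  - 9 * (c (PI / 12) 0 + c (7 * PI / 12) 0)
  + 3 * (c (7 * PI / 12) (- (PI / 2)) - c (PI / 12) (- (PI / 2))).

Definition num12 (k : nat) : R :=
  let c th := (1 / 2) ^ k * cos (INR k * th + 0) in
  - (9 / 4) * (c 0 + c PI) + 9 / 2 * c (PI / 3).

Lemma is_series_Catalan :
  exists s t : R,
    is_series (fun k => num24 (S k) / INR (S k) ^ 2) s /\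
    is_series (fun k => num12 (S k) / INR (S k) ^ 2) t /\
    Catalan = s + t.
Proof.
assert (H : forall r th al, Rabs r <= 1 ->
  is_series (fun k => r ^ S k * cos (INR (S k) * th + al) / INR (S k) ^ 2)
    (Li r th al)).
{ intros r th al Hr; apply Series_correct, ex_series_Li, Hr. }
assert (Hy : Rabs (/ sqrt 2) <= 1)
  by (pose proof inv_sqrt2_bounds; rewrite Rabs_pos_eq; lra).
assert (Hh : Rabs (1 / 2) <= 1) by (rewrite Rabs_pos_eq; lra).
do 2 eexists; split; [|split].
- eapply is_series_ext.
2:{ eapply is_series_plus; [eapply is_series_minus; [eapply is_series_plus|]|].
    + eapply (is_series_scal_l 6), is_series_plus.
      apply (H _ 0 0 Hy). apply (H _ PI 0 Hy).
    + eapply (is_series_scal_l 6), (H _ (PI / 4) 0 Hy).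
    + eapply (is_series_scal_l 9), is_series_plus.
      apply (H _ (PI / 12) 0 Hy). apply (H _ (7 * PI / 12) 0 Hy).
    + eapply (is_series_scal_l 3), is_series_minus.
      apply (H _ (7 * PI / 12) (- (PI / 2)) Hy).
      apply (H _ (PI / 12) (- (PI / 2)) Hy). }
  intros k; unfold num24, plus, opp, mult; cbn -[INR pow].
  unfold mult; cbn -[INR pow]; unfold Rdiv; ring.
- eapply is_series_ext.
2:{ eapply is_series_plus.
    + eapply (is_series_scal_l (- (9 / 4))), is_series_plus.
      apply (H _ 0 0 Hh). apply (H _ PI 0 Hh).
    + eapply (is_series_scal_l (9 / 2)), (H _ (PI / 3) 0 Hh). }
  intros k; unfold num12, plus, opp, mult; cbn -[INR pow].
  unfold mult; cbn -[INR pow]; unfold Rdiv; ring.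
- rewrite Catalan_Li; unfold plus, opp, mult; cbn -[Li].
  unfold mult; cbn -[Li]; ring.
Qed.

(** * Periodicity and values of the numerators *)

Lemma pow_cos_shift (r th al : R) (p k N : nat) :
  INR p * th = 2 * INR N * PI ->
  r ^ (p + k) * cos (INR (p + k) * th + al)
  = r ^ p * (r ^ k * cos (INR k * th + al)).
Proof.
intros E; rewrite pow_add, plus_INR.
replace ((INR p + INR k) * th + al) with (INR k * th + al + 2 * INR N * PI)
  by (rewrite <- E; ring).
rewrite cos_period; ring.
Qed.

Lemma inv_sqrt2_pow24 : (/ sqrt 2) ^ 24 = / 4096.
Proof.
replace ((/ sqrt 2) ^ 24) with ((/ sqrt 2 * / sqrt 2) ^ 12) by ring.
rewrite inv_sqrt2_sq; field.
Qed.

Lemma num24_period (k : nat) : num24 (24 + k) = num24 k / 4096.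
Proof.
unfold num24.
rewrite (pow_cos_shift _ 0 0 24 k 0), (pow_cos_shift _ PI 0 24 k 12),
  (pow_cos_shift _ (PI / 4) 0 24 k 3), (pow_cos_shift _ (PI / 12) 0 24 k 1),
  (pow_cos_shift _ (PI / 12) (- (PI / 2)) 24 k 1),
  (pow_cos_shift _ (7 * PI / 12) 0 24 k 7),
  (pow_cos_shift _ (7 * PI / 12) (- (PI / 2)) 24 k 7) by (simpl; field).
rewrite inv_sqrt2_pow24; field.
Qed.

Lemma num12_period (k : nat) : num12 (12 + k) = num12 k / 4096.
Proof.
unfold num12.
rewrite (pow_cos_shift _ 0 0 12 k 0), (pow_cos_shift _ PI 0 12 k 6),
  (pow_cos_shift _ (PI / 3) 0 12 k 2) by (simpl; field).
field.
Qed.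

Lemma cos_7PI12 : cos (7 * PI / 12) = - sin (PI / 12).
Proof. replace (7 * PI / 12) with (PI / 12 + PI / 2) by field; apply cos_add_PI2. Qed.

Lemma sin_7PI12 : sin (7 * PI / 12) = cos (PI / 12).
Proof.
replace (7 * PI / 12) with (PI / 12 + PI / 2) by field.
rewrite sin_plus, cos_PI2, sin_PI2; ring.
Qed.

Lemma cos_sub_PI2 (x : R) : cos (x + - (PI / 2)) = sin x.
Proof. rewrite cos_plus, cos_neg, sin_neg, cos_PI2, sin_PI2; ring. Qed.

(* The minimal polynomial of [e^(i PI / 12) / sqrt 2] and
   [e^(7 i PI / 12) / sqrt 2] is [X^4 - X^3 + X^2 / 2 - X / 2 + 1 / 4]. *)
Lemma pow_cos_rec4 (th al : R) (k : nat) :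
  th = PI / 12 \/ th = 7 * PI / 12 ->
  let c k := (/ sqrt 2) ^ k * cos (INR k * th + al) in
  c (S (S (S (S k))))
  = c (S (S (S k))) - c (S (S k)) / 2 + c (S k) / 2 - c k / 4.
Proof.
intros Hth c.
set (s := 2 * / sqrt 2 * cos th).
(* The two angles give [s = (1 + sqrt 3) / 2] and [s = (1 - sqrt 3) / 2], conjugate roots of one
   rational quadratic; eliminating [s] from the second-order recurrence gives the rational one of
   order 4. *)
assert (Hs : s * s = s + 1 / 2).
{ pose proof (sqrt_sqrt 3 ltac:(lra)).
  destruct inv_sqrt2_cos_sin_PI12 as [E E']; unfold s.
  destruct Hth as [-> | ->]; [|rewrite cos_7PI12].
  - replace (2 * / sqrt 2 * cos (PI / 12))
      with (2 * (/ sqrt 2 * cos (PI / 12))) by ring.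
    rewrite E; lra.
  - replace (2 * / sqrt 2 * - sin (PI / 12))
      with (- (2 * (/ sqrt 2 * sin (PI / 12)))) by ring.
    rewrite E'; lra. }
assert (R : forall k, c (S (S k)) = s * c (S k) - c k / 2).
{ intros j; unfold c at 1; rewrite pow_cos_recurrence; fold (c (S j)) (c j).
  fold s; simpl pow at 1; rewrite Rmult_1_r, inv_sqrt2_sq; field. }
rewrite (R (S (S k))), (R (S k)), (R k).
set (a := c (S k)); set (b := c k); clearbody a b s.
transitivity (s * s * (s * a - b / 2) - s * a + b / 4); [field|].
rewrite Hs; field_simplify; replace (s ^ 2) with (s + 1 / 2) by (rewrite <- Hs; ring).
field.
Qed.

(** Entry [j] is the value of [num24] at [S j]. The numerator of [nu] over [(24 m + i) ^ 2] is 4096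
    times entry [i - 1] of this list, plus, for even [i], 4 * 4096 times entry [i / 2 - 1] of
    [coef12]. *)
Definition coef24 : list R :=
  [0; 9/2; -15/2; -3/4; 0; 3/4; -3/8; 27/16; 9/16; 9/32; 3/32; 3/8; 0; 15/128;
   15/128; 27/256; 0; 9/256; 3/512; -3/1024; -9/1024; 15/2048; -3/2048; 0].

Definition coef12 : list R :=
  [9/8; -27/16; -9/16; -27/64; 9/128; 0; 9/512; -27/1024; -9/1024; -27/4096;
   9/8192; 0].

Ltac instances H n :=
  pose proof (H n); match n with S ?m => instances H m | O => idtac end.

(** The terms are grouped so that each group obeys a recurrence with rational coefficients; the
    square roots then have to cancel in the initial values only, and the rest is linear
    arithmetic. *)
Lemma num24_values (j : nat) : (j < 24)%nat ->
  num24 (S j) = nth j coef24 0.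
Proof.
set (c := fun th al k => (/ sqrt 2) ^ k * cos (INR k * th + al)).
set (u := fun k => c 0 0 k + c PI 0 k).
set (v := c (PI / 4) 0).
set (p := fun k => - 9 * (c (PI / 12) 0 k + c (7 * PI / 12) 0 k)
  + 3 * (c (7 * PI / 12) (- (PI / 2)) k - c (PI / 12) (- (PI / 2)) k)).
assert (E : forall k, num24 k = 6 * u k + 6 * v k + p k).
{ intros k; unfold num24, u, v, p, c; ring. }
assert (Ru : forall k, u (S (S k)) = u k / 2).
{ intros k; unfold u, c.
  change (S (S k)) with (2 + k)%nat.
  rewrite (pow_cos_shift _ 0 0 2 k 0), (pow_cos_shift _ PI 0 2 k 1) by (simpl; ring).
  replace ((/ sqrt 2) ^ 2) with (/ sqrt 2 * / sqrt 2) by ring.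
  rewrite inv_sqrt2_sq; field. }
assert (Rv : forall k, v (S (S k)) = v (S k) - v k / 2).
{ intros k; unfold v, c; rewrite pow_cos_recurrence, cos_PI4.
  replace (2 * / sqrt 2 * (1 / sqrt 2)) with (2 * (/ sqrt 2 * / sqrt 2))
    by (unfold Rdiv; ring).
  replace ((/ sqrt 2) ^ 2) with (/ sqrt 2 * / sqrt 2) by ring.
  rewrite inv_sqrt2_sq; field. }
assert (Rp : forall k, p (S (S (S (S k))))
  = p (S (S (S k))) - p (S (S k)) / 2 + p (S k) / 2 - p k / 4).
{ intros k.
  assert (Rc : forall th al, th = PI / 12 \/ th = 7 * PI / 12 -> c th al (S (S (S (S k))))
    = c th al (S (S (S k))) - c th al (S (S k)) / 2 + c th al (S k) / 2
      - c th al k / 4) by (intros th al Hth; exact (pow_cos_rec4 th al k Hth)).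
  unfold p.
  rewrite (Rc (PI / 12) 0), (Rc (7 * PI / 12) 0), (Rc (PI / 12) (- (PI / 2))),
    (Rc (7 * PI / 12) (- (PI / 2))) by auto.
  field. }
assert (Hi : u 0%nat = 2 /\ u 1%nat = 0 /\ v 0%nat = 1 /\ v 1%nat = 1 / 2 /\
  p 0%nat = -18 /\ p 1%nat = -3).
{ unfold u, v, p, c; cbn [INR pow]; rewrite !Rmult_0_l, !Rmult_1_l, !Rmult_1_r.
  rewrite !Rplus_0_l, !cos_neg, cos_PI2, !cos_sub_PI2, !Rplus_0_r.
  rewrite cos_0, cos_PI, sin_7PI12, cos_7PI12, cos_PI4.
  destruct inv_sqrt2_cos_sin_PI12 as [Ec Es].
  pose proof inv_sqrt2_sq as Ey; unfold Rdiv in *.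
  repeat split; lra. }
destruct Hi as (u0 & u1 & v0 & v1 & p0 & p1).
(* The order-4 recurrence needs four initial values; these two come from the second-order one, whose
   coefficient involves [sqrt 3]. *)
assert (Hp : p 2%nat = - 3 / 2 /\ p 3%nat = - 6).
{ pose proof (sqrt_sqrt 3 ltac:(lra)) as X2.
  assert (X3 : sqrt 3 * sqrt 3 * sqrt 3 = 3 * sqrt 3) by now rewrite X2.
  assert (R2 : forall th al k,
    c th al (S (S k)) = 2 * (/ sqrt 2 * cos th) * c th al (S k) - c th al k / 2).
  { intros th al k; unfold c; rewrite pow_cos_recurrence.
    replace ((/ sqrt 2) ^ 2) with (/ sqrt 2 * / sqrt 2) by ring.
    rewrite inv_sqrt2_sq; unfold Rdiv; ring. }
  assert (C0 : forall th al, c th al 0%nat = cos al).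
  { intros th al; unfold c; simpl; now rewrite Rmult_0_l, Rplus_0_l, Rmult_1_l. }
  assert (C1 : forall th al, c th al 1%nat = / sqrt 2 * cos (th + al)).
  { intros th al; unfold c; simpl; now rewrite Rmult_1_l, Rmult_1_r. }
  destruct inv_sqrt2_cos_sin_PI12 as [Ec Es].
  unfold p; rewrite !R2, !C0, !C1, !cos_sub_PI2, !Rplus_0_r, cos_neg, cos_0, cos_PI2.
  rewrite sin_7PI12, cos_7PI12, Ropp_mult_distr_r_reverse, Ec, Es.
  split; lra. }
destruct Hp as [p2 p3].
clearbody u v p; clear c.
intros Hj; rewrite E; clear E.
instances Ru 22%nat; instances Rv 22%nat; instances Rp 20%nat.
unfold coef24; do 24 (destruct j as [|j]; [cbn [nth]; lra|]); lia.
Qed.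

Lemma num12_values (j : nat) : (j < 12)%nat ->
  num12 (S j) = nth j coef12 0.
Proof.
set (c := fun th k => (1 / 2) ^ k * cos (INR k * th + 0)).
set (u := fun k => c 0 k + c PI k); set (v := c (PI / 3)).
assert (E : forall k, num12 k = - (9 / 4) * u k + 9 / 2 * v k) by easy.
assert (Ru : forall k, u (S (S k)) = u k / 4).
{ intros k; unfold u, c.
  change (S (S k)) with (2 + k)%nat.
  rewrite (pow_cos_shift _ 0 0 2 k 0), (pow_cos_shift _ PI 0 2 k 1) by (simpl; ring).
  field. }
assert (Rv : forall k, v (S (S k)) = v (S k) / 2 - v k / 4).
{ intros k; unfold v, c; rewrite pow_cos_recurrence, cos_PI3; field. }
assert (Hi : u 0%nat = 2 /\ u 1%nat = 0 /\ v 0%nat = 1 /\ v 1%nat = 1 / 4).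
{ unfold u, v, c; cbn [INR pow].
  rewrite !Rmult_0_l, !Rplus_0_r, !Rmult_1_l, cos_0, cos_PI, cos_PI3; lra. }
destruct Hi as (u0 & u1 & v0 & v1).
clearbody u v; clear c.
intros Hj; rewrite E; clear E.
instances Ru 10%nat; instances Rv 10%nat.
unfold coef12; do 12 (destruct j as [|j]; [cbn [nth]; lra|]); lia.
Qed.

Lemma num24_block (m j : nat) : (j < 24)%nat ->
  num24 (S (j + m * 24)) = num24 (S j) * / 4096 ^ m.
Proof.
intros Hj; induction m as [|m IH].
- rewrite Nat.mul_0_l, Nat.add_0_r; simpl; field.
- replace (S (j + S m * 24)) with (24 + S (j + m * 24))%nat by lia.
  rewrite num24_period, IH; simpl; field; apply pow_nonzero; lra.
Qed.

Lemma num12_block (m j : nat) : (j < 12)%nat ->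
  num12 (S (j + m * 12)) = num12 (S j) * / 4096 ^ m.
Proof.
intros Hj; induction m as [|m IH].
- rewrite Nat.mul_0_l, Nat.add_0_r; simpl; field.
- replace (S (j + S m * 12)) with (12 + S (j + m * 12))%nat by lia.
  rewrite num12_period, IH; simpl; field; apply pow_nonzero; lra.
Qed.

Lemma INR_block (m j p : nat) :
  INR (S (j + m * p)) = INR p * INR m + IZR (Z.of_nat (S j)).
Proof.
rewrite <- INR_IZR_INZ, !S_INR, plus_INR, mult_INR; ring.
Qed.

Lemma is_series_nu :
  is_series (fun m => nu m / 4096 ^ m) (4096 * Catalan).
Proof.
destruct is_series_Catalan as (s & t & Hs & Ht & ->).
apply (is_series_blocks _ 23) in Hs; apply (is_series_blocks _ 11) in Ht.
pose proof (is_series_scal_l 4096 _ _ (is_series_plus _ _ _ _ Hs Ht)) as H.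
unfold plus, mult in H; cbn -[INR pow sum_n] in H; unfold mult in H;
  cbn -[INR pow sum_n] in H.
revert H; apply is_series_ext; intros m.
set (q := / 4096 ^ m).
(* A denominator [12 m + j] of the second series is written as half of [24 m + 2 j], hence the
   factor 4; its terms then merge with the even positions of the first series. *)
transitivity (4096 * (
  sum_n (fun j => nth j coef24 0 * q * / (24 * INR m + IZR (Z.of_nat (S j))) ^ 2) 23
  + sum_n (fun j => nth j coef12 0 * q
      * (4 * / (24 * INR m + IZR (2 * Z.of_nat (S j))) ^ 2)) 11)).
- do 2 f_equal; apply sum_n_ext_loc; intros j Hj.
  + rewrite num24_block, num24_values, INR_block by lia.
    now replace (INR 24) with 24 by (simpl; ring).
  + rewrite num12_block, num12_values, INR_block by lia.
    unfold Rdiv; f_equal; rewrite mult_IZR.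
    replace (INR 12) with 12 by (simpl; ring).
    pose proof (pos_INR m); assert (0 < IZR (Z.of_nat (S j))) by (apply IZR_lt; lia).
    field; lra.
- rewrite !sum_Sn, !sum_O; unfold plus; cbn -[INR pow Rplus Rmult].
  unfold nu, Rdiv; fold q; lra.
Qed.

(** * Certified inequalities between rational functions *)

(** Reification makes the clearing of denominators a computation on lists of integers, run by
    [vm_compute], instead of a rewriting of real terms with the very large coefficients of [MC4]. *)
Inductive rexpr : Set :=
  | Cst (z : Z)
  | Var
  | Add (e f : rexpr)
  | Sub (e f : rexpr)
  | Opp (e : rexpr)
  | Mul (e f : rexpr)
  | Div (e f : rexpr)
  | Pow (e : rexpr) (k : nat).

Fixpoint eval (e : rexpr) (x : R) : R :=
  match e with
  | Cst z => IZR z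
  | Var => x
  | Add e f => eval e x + eval f x
  | Sub e f => eval e x - eval f x
  | Opp e => - eval e x
  | Mul e f => eval e x * eval f x
  | Div e f => eval e x / eval f x
  | Pow e k => eval e x ^ k
  end.

(* Coefficients in increasing degree. *)
Fixpoint peval (p : list Z) (y : R) : R :=
  match p with
  | [] => 0
  | c :: p => IZR c + y * peval p y
  end.

Fixpoint padd (p q : list Z) : list Z :=
  match p, q with
  | [], _ => q
  | _, [] => p
  | a :: p, b :: q => (a + b)%Z :: padd p q
  end.

Definition pscale (c : Z) (p : list Z) : list Z := map (Z.mul c) p.

Fixpoint pmul (p q : list Z) : list Z :=
  match p with
  | [] => []
  | a :: p => padd (pscale a q) (0%Z :: pmul p q)
  end.

Fixpoint ppow (p : list Z) (k : nat) : list Z :=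
  match k with
  | O => [1%Z]
  | S k => pmul p (ppow p k)
  end.

Definition ppos (p : list Z) : bool :=
  match p with
  | [] => false
  | c :: p => (0 <? c)%Z && forallb (Z.leb 0) p
  end.

Lemma peval_padd (p q : list Z) (y : R) :
  peval (padd p q) y = peval p y + peval q y.
Proof.
revert q; induction p as [|a p IH]; intros [|b q]; simpl; try ring.
rewrite IH, plus_IZR; ring.
Qed.

Lemma peval_pscale (c : Z) (p : list Z) (y : R) :
  peval (pscale c p) y = IZR c * peval p y.
Proof.
unfold pscale; induction p as [|a p IH]; simpl; [ring|].
rewrite IH, mult_IZR; ring.
Qed.

Lemma peval_pmul (p q : list Z) (y : R) :
  peval (pmul p q) y = peval p y * peval q y.
Proof.
induction p as [|a p IH]; simpl; [ring|].
rewrite peval_padd, peval_pscale; simpl; rewrite IH; ring.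
Qed.

Lemma peval_ppow (p : list Z) (k : nat) (y : R) :
  peval (ppow p k) y = peval p y ^ k.
Proof.
induction k as [|k IH]; simpl; [ring|].
rewrite peval_pmul, IH; ring.
Qed.

Lemma ppos_peval (p : list Z) (y : R) :
  0 <= y -> ppos p = true -> 0 < peval p y.
Proof.
intros Hy; destruct p as [|c p]; simpl; [discriminate|].
intros H; apply andb_prop in H; destruct H as [Hc Hp].
apply Z.ltb_lt, IZR_lt in Hc.
assert (0 <= peval p y) as H.
{ induction p as [|d p IH]; simpl in *; [lra|].
  apply andb_prop in Hp; destruct Hp as [Hd Hp].
  apply Z.leb_le, IZR_le in Hd.
  pose proof (Rmult_le_pos _ _ Hy (IH Hp)); lra. }
pose proof (Rmult_le_pos _ _ Hy H); lra.
Qed.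

Definition pcontent (p : list Z) : Z := fold_right Z.gcd 0%Z p.

(** Removes the common integer content, so that the denominators of the continued fraction
    coefficients do not accumulate from level to level; common polynomial factors are kept. *)
Definition preduce (n d : list Z) : list Z * list Z :=
  let g := Z.gcd (pcontent n) (pcontent d) in
  (map (fun c => (c / g)%Z) n, map (fun c => (c / g)%Z) d).

Lemma peval_div (g : Z) (p : list Z) (y : R) :
  (g | pcontent p)%Z -> g <> 0%Z ->
  peval p y = IZR g * peval (map (fun c => (c / g)%Z) p) y.
Proof.
intros H Hg; induction p as [|c p IH]; simpl in *; [ring|].
assert (g | c)%Z as [k ->].
{ apply (Z.divide_trans _ _ _ H), Z.gcd_divide_l. }
rewrite Z.div_mul by exact Hg.
rewrite IH, mult_IZR; [ring|].
apply (Z.divide_trans _ _ _ H), Z.gcd_divide_r.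
Qed.

Lemma preduce_correct (n d n' d' : list Z) (y : R) :
  0 < peval d y -> Some (preduce n d) = Some (n', d') ->
  0 < peval d' y /\ peval n y / peval d y = peval n' y / peval d' y.
Proof.
unfold preduce; set (g := Z.gcd _ _); intros Hd H; injection H as <- <-.
assert (0 <= g)%Z as Hg0 by apply Z.gcd_nonneg.
assert (g <> 0%Z) as Hg.
{ intros Hg; apply Z.gcd_eq_0_r in Hg.
  assert (peval d y = 0) as E; [|lra].
  clear - Hg; induction d as [|c d IH]; simpl in *; [reflexivity|].
  rewrite IH by exact (Z.gcd_eq_0_r _ _ Hg).
  rewrite (Z.gcd_eq_0_l _ _ Hg); ring. }
rewrite (peval_div g n), (peval_div g d) in *; try exact Hg;
  try apply Z.gcd_divide_l; try apply Z.gcd_divide_r.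
assert (0 < IZR g) by (apply IZR_lt; lia).
assert (0 < peval (map (fun c => (c / g)%Z) d) y) as Hd' by nra.
split; [exact Hd'|field; lra].
Qed.

(* [ratfun s e] computes [e] at [s + y] as a quotient of polynomials in [y]
   whose denominator is positive for [0 <= y]; it fails unless every divisor
   occurring in [e] has coefficients of a constant sign. *)
Fixpoint ratfun (s : Z) (e : rexpr) : option (list Z * list Z) :=
  match e with
  | Cst z => Some ([z], [1%Z])
  | Var => Some ([s; 1%Z], [1%Z])
  | Add e f =>
      match ratfun s e, ratfun s f with
      | Some (n, d), Some (n', d') =>
          Some (padd (pmul n d') (pmul n' d), pmul d d')
      | _, _ => None
      end
  | Sub e f =>
      match ratfun s e, ratfun s f with
      | Some (n, d), Some (n', d') =>
          Some (padd (pmul n d') (pscale (-1) (pmul n' d)), pmul d d')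
      | _, _ => None
      end
  | Opp e =>
      match ratfun s e with
      | Some (n, d) => Some (pscale (-1) n, d)
      | None => None
      end
  | Mul e f =>
      match ratfun s e, ratfun s f with
      | Some (n, d), Some (n', d') => Some (pmul n n', pmul d d')
      | _, _ => None
      end
  | Div e f =>
      match ratfun s e, ratfun s f with
      | Some (n, d), Some (n', d') =>
          if ppos n' then Some (preduce (pmul n d') (pmul d n'))
          else if ppos (pscale (-1) n')
          then Some (preduce (pscale (-1) (pmul n d')) (pscale (-1) (pmul d n')))
          else None
      | _, _ => None
      end
  | Pow e k =>
      match ratfun s e with
      | Some (n, d) => Some (ppow n k, ppow d k)
      | None => None
      end
  end.

Lemma ratfun_correct (s : Z) (y : R) (e : rexpr) :
  0 <= y -> forall n d : list Z, ratfun s e = Some (n, d) ->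
  0 < peval d y /\ eval e (IZR s + y) = peval n y / peval d y.
Proof.
intros Hy; induction e as [z| |e IHe f IHf|e IHe f IHf|e IHe|e IHe f IHf
  |e IHe f IHf|e IHe k]; cbn [ratfun eval]; intros n d H;
  try (destruct (ratfun s e) as [[ne de]|]; [|discriminate];
       destruct (IHe _ _ eq_refl) as [He Ee]; rewrite Ee);
  try (destruct (ratfun s f) as [[nf df]|]; [|discriminate];
       destruct (IHf _ _ eq_refl) as [Hf Ef]; rewrite Ef);
  try (injection H as <- <-);
  rewrite ?peval_padd, ?peval_pscale, ?peval_pmul, ?peval_ppow.
- simpl; split; [lra|field; lra].
- simpl; split; [lra|field; lra].
- split; [nra|field; lra].
- split; [nra|field; lra].
- split; [nra|field; lra].
- split; [nra|field; lra].
- destruct (ppos nf) eqn:P.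
  + apply (ppos_peval _ y Hy) in P.
    apply (preduce_correct _ _ _ _ y) in H.
    * destruct H as [Hd <-]; split; [exact Hd|].
      rewrite !peval_pmul; field; lra.
    * rewrite peval_pmul; nra.
  + destruct (ppos (pscale (-1) nf)) eqn:N; [|discriminate].
    apply (ppos_peval _ y Hy) in N; rewrite peval_pscale in N.
    apply (preduce_correct _ _ _ _ y) in H.
    * destruct H as [Hd <-]; split; [exact Hd|].
      rewrite !peval_pscale, !peval_pmul; field; lra.
    * rewrite peval_pscale, peval_pmul; nra.
- split; [apply pow_lt; lra|].
  unfold Rdiv; rewrite Rpow_mult_distr, pow_inv; reflexivity.
Qed.

Definition rmul (p q : list Z * list Z) : list Z * list Z :=
  (pmul (fst p) (fst q), pmul (snd p) (snd q)).

Definition rlt (p q : list Z * list Z) : bool :=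
  ppos (padd (pmul (fst q) (snd p)) (pscale (-1) (pmul (fst p) (snd q)))).

Lemma rlt_correct (p q : list Z * list Z) (y : R) :
  0 <= y -> 0 < peval (snd p) y -> 0 < peval (snd q) y -> rlt p q = true ->
  peval (fst p) y / peval (snd p) y < peval (fst q) y / peval (snd q) y.
Proof.
unfold rlt; intros Hy Hp Hq H; apply (ppos_peval _ _ Hy) in H.
rewrite peval_padd, peval_pscale, !peval_pmul in H.
apply Rlt_0_minus.
replace (_ - _) with
  ((peval (fst q) y * peval (snd p) y - peval (fst p) y * peval (snd q) y)
   / (peval (snd q) y * peval (snd p) y)) by (field; lra).
apply Rdiv_lt_0_compat; [lra|now apply Rmult_lt_0_compat].
Qed.

(* The two inequalities are checked together so that [ratfun s e] is computed
   only once. *)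
Definition between_from (s : Z) (l v e w u : rexpr) : bool :=
  match ratfun s l, ratfun s v, ratfun s e, ratfun s w, ratfun s u with
  | Some l, Some v, Some e, Some w, Some u => rlt l (rmul v e) && rlt (rmul w e) u
  | _, _, _, _, _ => false
  end.

Lemma between_from_correct (s : Z) (l v e w u : rexpr) (x : R) :
  between_from s l v e w u = true -> IZR s <= x ->
  eval l x < eval v x * eval e x /\ eval w x * eval e x < eval u x.
Proof.
unfold between_from; intros H Hx.
assert (Hy : 0 <= x - IZR s) by lra.
destruct (ratfun s l) as [[nl dl]|] eqn:El; [|discriminate].
destruct (ratfun s v) as [[nv dv]|] eqn:Ev; [|discriminate].
destruct (ratfun s e) as [[ne de]|] eqn:Ee; [|discriminate].
destruct (ratfun s w) as [[nw dw]|] eqn:Ew; [|discriminate].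
destruct (ratfun s u) as [[nu du]|] eqn:Eu; [|discriminate].
apply (ratfun_correct s _ _ Hy) in El, Ev, Ee, Ew, Eu.
replace (IZR s + (x - IZR s)) with x in * by ring.
destruct El as [Hl ->], Ev as [Hv ->], Ee as [He ->], Ew as [Hw ->],
  Eu as [Hu ->].
apply andb_prop in H; destruct H as [H1 H2].
unfold rmul in *; apply (rlt_correct _ _ _ Hy) in H1, H2; simpl fst in *;
  simpl snd in *; rewrite ?peval_pmul in *; try assumption;
  try now apply Rmult_lt_0_compat.
split.
- replace (_ * _) with (peval nv (x - IZR s) * peval ne (x - IZR s)
    / (peval dv (x - IZR s) * peval de (x - IZR s))) by (field; lra).
  exact H1.
- replace (_ * _) with (peval nw (x - IZR s) * peval ne (x - IZR s)
    / (peval dw (x - IZR s) * peval de (x - IZR s))) by (field; lra).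
  exact H2.
Qed.

Ltac reify x t :=
  lazymatch t with
  | x => constr:(Var)
  | IZR ?z => constr:(Cst z)
  | ?a + ?b => let e := reify x a in let f := reify x b in constr:(Add e f)
  | ?a - ?b => let e := reify x a in let f := reify x b in constr:(Sub e f)
  | - ?a => let e := reify x a in constr:(Opp e)
  | ?a * ?b => let e := reify x a in let f := reify x b in constr:(Mul e f)
  | ?a / ?b => let e := reify x a in let f := reify x b in constr:(Div e f)
  | ?a ^ ?k => let e := reify x a in constr:(Pow e k)
  end.

Ltac rational_between s x :=
  lazymatch goal with
  | |- ?l < ?v * ?t /\ ?w * ?t < ?u =>
      let el := reify x l in
      let ev := reify x v in
      let e := reify x t in
      let ew := reify x w in
      let eu := reify x u in
      refine (between_from_correct s el ev e ew eu x _ _);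
      [vm_compute; reflexivity | assumption]
  end.

(* [4096 ^ (m + 1) * (E4 m - E4 (m + 1))] *)
Definition step (m : nat) : R :=
  nu m - MC4 (INR m) + MC4 (INR m + 1) / 4096.

(** The 13th powers are moved to the side of [step m], so that both inequalities compare a multiple
    of the same rational function with the constant [C4]. *)
Lemma step_bounds (m : nat) : 12 <= INR m ->
  C4 / INR m ^ 13 < step m /\ step m < C4 / (INR m + 4) ^ 13.
Proof.
intros Hm.
assert (C4 < INR m ^ 13 * step m /\ (INR m + 4) ^ 13 * step m < C4) as [Hl Hu].
{ unfold step, nu, MC4, C4, MC4_coeffs; cbn [contfrac].
  set (x := INR m) in *; clearbody x.
  rational_between 12%Z x. }
split; [apply Rlt_div_l|apply Rlt_div_r]; try (apply pow_lt; lra); lra.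
Qed.

(** A crude bound, used for the limit of [E4]. The factor 1 introduced in the proof matches the
    shape [rational_between] expects. *)
Lemma MC4_bounds (x : R) : 12 <= x -> -1 < MC4 x /\ MC4 x < 1.
Proof.
intros Hx; rewrite <- (Rmult_1_l (MC4 x)).
unfold MC4, MC4_coeffs; cbn [contfrac].
rational_between 12%Z x.
Qed.

(** * The remainder *)

Lemma E4_step (n : nat) : (1 <= n)%nat ->
  E4 n - E4 (S n) = step n / 4096 ^ S n.
Proof.
intros Hn; unfold E4, step.
replace (S n - 1)%nat with (S (n - 1)) by lia.
rewrite tech5; replace (S (n - 1)) with n by lia.
rewrite !Nat.add_1_r, (S_INR n); simpl pow.
field; apply pow_nonzero; lra.
Qed.

Lemma is_lim_seq_inv_pow4096 : is_lim_seq (fun n => / 4096 ^ n) 0.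
Proof.
apply (is_lim_seq_ext (fun n => (/ 4096) ^ n)); [intros n; apply pow_inv|].
apply is_lim_seq_geom; rewrite Rabs_pos_eq; lra.
Qed.

Lemma is_lim_seq_div_pow4096 (u : nat -> R) (c : R) (N : nat) :
  (forall n, (N <= n)%nat -> Rabs (u n) <= c) ->
  is_lim_seq (fun n => u n / 4096 ^ n) 0.
Proof.
intros Hu; apply is_lim_seq_abs_0.
apply (is_lim_seq_le_le_loc (fun _ => 0) _ (fun n => c * / 4096 ^ n)).
- exists N; intros n Hn; split; [apply Rabs_pos|].
  assert (0 < / 4096 ^ n) by (apply Rinv_0_lt_compat, pow_lt; lra).
  unfold Rdiv; rewrite Rabs_mult, (Rabs_pos_eq (/ _)) by lra.
  apply Rmult_le_compat_r; [lra|now apply Hu].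
- apply is_lim_seq_const.
- replace (Finite 0) with (Rbar_mult c 0) by (simpl; now rewrite Rmult_0_r).
  apply is_lim_seq_scal_l, is_lim_seq_inv_pow4096.
Qed.

Lemma INR_ge_12 (n : nat) : (12 <= n)%nat -> 12 <= INR n.
Proof. intros Hn; apply le_INR in Hn; simpl in Hn; lra. Qed.

Lemma is_lim_seq_E4 : is_lim_seq E4 0.
Proof.
apply (is_lim_seq_incr_1 E4).
assert (HS : is_lim_seq (sum_n (fun m => nu m / 4096 ^ m)) (4096 * Catalan))
  by exact is_series_nu.
assert (HM : is_lim_seq (fun n => MC4 (INR (S n)) / 4096 / 4096 ^ S n) 0).
{ apply (proj1 (is_lim_seq_incr_1 (fun n => MC4 (INR n) / 4096 / 4096 ^ n) 0)).
  apply (is_lim_seq_div_pow4096 _ 1 12); intros n Hn.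
  pose proof (MC4_bounds _ (INR_ge_12 n Hn)); apply Rabs_le; lra. }
apply (is_lim_seq_ext (fun n => Catalan
  - / 4096 * sum_n (fun m => nu m / 4096 ^ m) n
  - MC4 (INR (S n)) / 4096 / 4096 ^ S n)).
- intros n; unfold E4; rewrite sum_n_Reals, Nat.add_1_r.
  replace (S n - 1)%nat with n by lia.
  rewrite <- (tech_pow_Rmult 4096 (S n)); field; apply pow_nonzero; lra.
- replace 0 with (Catalan - / 4096 * (4096 * Catalan) - 0) by field.
  apply is_lim_seq_minus'; [|exact HM].
  apply is_lim_seq_minus'; [apply is_lim_seq_const|].
  apply (is_lim_seq_scal_l _ (/ 4096) _ HS).
Qed.

(** * From the bounds on one step to the bounds on the remainder *)

(** Takes the place of a summation: it is applied to the differences between [E4] and its two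
    bounds, which decrease as soon as the one-step inequalities hold. *)
Lemma pos_of_decreasing_to_0 (u : nat -> R) (N : nat) :
  (forall n, (N <= n)%nat -> u (S n) < u n) ->
  is_lim_seq u 0 -> forall n, (N <= n)%nat -> 0 < u n.
Proof.
intros Hd Hl n Hn.
apply Rle_lt_trans with (u (S n)); [|now apply Hd].
apply (is_lim_seq_decr_compare (fun k => u (k + S n)%nat)) with (n := 0%nat).
- now apply is_lim_seq_incr_n.
- intros k; simpl; left; apply Hd; lia.
Qed.

Lemma is_lim_seq_bound (s : R) : 0 <= s ->
  is_lim_seq (fun n => C4 / (4095 * 4096 ^ n * (INR n + s) ^ 13)) 0.
Proof.
intros Hs.
apply (is_lim_seq_ext_loc (fun n => C4 / 4095 / (INR n + s) ^ 13 / 4096 ^ n)).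
- exists 1%nat; intros n Hn; apply le_INR in Hn; simpl in Hn.
  field; split; (lra || (apply pow_nonzero; lra)).
- apply (is_lim_seq_div_pow4096 _ (Rabs (C4 / 4095)) 1).
  intros n Hn; apply le_INR in Hn; simpl in Hn.
  assert (1 <= (INR n + s) ^ 13) by (apply pow_R1_Rle; lra).
  unfold Rdiv at 1; rewrite Rabs_mult.
  rewrite <- (Rmult_1_r (Rabs (C4 / 4095))) at 2.
  apply Rmult_le_compat_l; [apply Rabs_pos|].
  rewrite Rabs_pos_eq by (left; apply Rinv_0_lt_compat; lra).
  rewrite <- Rinv_1; apply Rinv_le_contravar; lra.
Qed.

Lemma bound_step (s : R) (n : nat) : 0 < INR n + s ->
  C4 / (4095 * 4096 ^ n * (INR n + s) ^ 13)
    - C4 / (4095 * 4096 ^ S n * (INR (S n) + s) ^ 13)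
  = C4 / 4095 * (4096 * / (INR n + s) ^ 13 - / (INR n + s + 1) ^ 13)
    / 4096 ^ S n.
Proof.
intros H; rewrite S_INR; simpl (4096 ^ S n).
replace (INR n + 1 + s) with (INR n + s + 1) by ring.
field; repeat split; (lra || (apply pow_nonzero; lra)).
Qed.

Lemma inv_pow_decr (x : R) (k : nat) : 0 < x -> / (x + 1) ^ k <= / x ^ k.
Proof.
intros Hx; apply Rinv_le_contravar; [now apply pow_lt|].
apply pow_incr; lra.
Qed.

(** From [x (x + 2) <= (x + 1) ^ 2] the middle value squared is at most the product of the outer
    ones; the inequality of arithmetic and geometric means does the rest. *)
Lemma inv_pow_convex (x : R) (k : nat) : 0 < x ->
  2 * / (x + 1) ^ k <= / x ^ k + / (x + 1 + 1) ^ k.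
Proof.
intros Hx.
assert (Ha : 0 < / x ^ k) by (apply Rinv_0_lt_compat, pow_lt; lra).
assert (Hb : 0 < / (x + 1) ^ k) by (apply Rinv_0_lt_compat, pow_lt; lra).
assert (Hc : 0 < / (x + 1 + 1) ^ k) by (apply Rinv_0_lt_compat, pow_lt; lra).
assert (H : / (x + 1) ^ k * / (x + 1) ^ k <= / x ^ k * / (x + 1 + 1) ^ k).
{ rewrite <- !Rinv_mult, <- !Rpow_mult_distr.
  apply Rinv_le_contravar; [apply pow_lt; nra|].
  apply pow_incr; nra. }
revert Ha Hb Hc H.
generalize (/ x ^ k) (/ (x + 1) ^ k) (/ (x + 1 + 1) ^ k); intros a b c Ha Hb Hc H.
apply Rsqr_incr_0; [|lra|lra]; unfold Rsqr.
pose proof (Rle_0_sqr (a - c)) as S; unfold Rsqr in S; lra.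
Qed.

Lemma C4_neg : C4 < 0.
Proof. unfold C4; lra. Qed.

Theorem theorem4 (n : nat) (hn : (12 <= n)%nat) :
  C4 / (4095 * 4096 ^ n * INR n ^ 13) < E4 n /\
  E4 n < C4 / (4095 * 4096 ^ n * (INR n + 5) ^ 13).
Proof.
pose proof C4_neg as HC.
assert (Hq : forall k, 0 < / 4096 ^ S k)
  by (intros k; apply Rinv_0_lt_compat, pow_lt; lra).
split; apply Rlt_0_minus.
- rewrite <- (Rplus_0_r (INR n)).
  apply (pos_of_decreasing_to_0
    (fun n => E4 n - C4 / (4095 * 4096 ^ n * (INR n + 0) ^ 13)) 12);
    [|rewrite <- (Rminus_0_r 0); apply is_lim_seq_minus';
      [apply is_lim_seq_E4|apply is_lim_seq_bound; lra]|exact hn].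
  intros k Hk; pose proof (INR_ge_12 k Hk) as Hx.
  pose proof (E4_step k ltac:(lia)) as E.
  pose proof (bound_step 0 k ltac:(lra)) as B.
  destruct (step_bounds k Hx) as [H _].
  rewrite !Rplus_0_r in *; unfold Rdiv in H.
  pose proof (inv_pow_decr (INR k) 13 ltac:(lra)).
  (* By monotonicity the bracket is at least [4095 * / INR k ^ 13]; the sign of [C4] reverses
     this. *)
  assert (H1 : C4 / 4095 * (4096 * / INR k ^ 13 - / (INR k + 1) ^ 13) < step k)
    by nra.
  apply (Rmult_lt_compat_r _ _ _ (Hq k)) in H1.
  unfold Rdiv in *; lra.
- apply (pos_of_decreasing_to_0
    (fun n => C4 / (4095 * 4096 ^ n * (INR n + 5) ^ 13) - E4 n) 12);
    [|rewrite <- (Rminus_0_r 0); apply is_lim_seq_minus';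
      [apply is_lim_seq_bound; lra|apply is_lim_seq_E4]|exact hn].
  intros k Hk; pose proof (INR_ge_12 k Hk) as Hx.
  pose proof (E4_step k ltac:(lia)) as E.
  pose proof (bound_step 5 k ltac:(lra)) as B.
  destruct (step_bounds k Hx) as [_ H]; unfold Rdiv in H.
  pose proof (inv_pow_convex (INR k + 4) 13 ltac:(lra)) as H2.
  pose proof (inv_pow_decr (INR k + 4) 13 ltac:(lra)) as H3.
  replace (INR k + 4 + 1) with (INR k + 5) in * by ring.
  (* Write [a], [b], [c] for the inverse powers at shifts 4, 5, 6. Then [2 b <= a + c] together with
     4094 times [b <= a] gives [4096 b - c <= 4095 a], and [C4] is negative. *)
  assert (H1 : step k
    < C4 / 4095 * (4096 * / (INR k + 5) ^ 13 - / (INR k + 5 + 1) ^ 13)) by nra.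
  apply (Rmult_lt_compat_r _ _ _ (Hq k)) in H1.
  unfold Rdiv in *; lra.
Qed.
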